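(* Let $L$ be a triangulation of the $k$-dimensional simplex such that the only vertices of $L$ on the boundary of the simplex are the original vertices of the simplex. For all $n\geq 0$, the generalized Tchebyshev polynomials of the first kind $T^L_n(x)$ have the following properties: (1) $T^L_n(x)$ is a polynomial of degree $n$; (2) $T^L_n(1)=1$; (3) $(-1)^n T^L_n(-x)=T^L_n(x)$; (4) all real roots of $T^L_n(x)$ belong to the interval $(-1,1)$.
   Context: Simplicial complexes are finite abstract simplicial complexes, containing the empty face; $k\geq 1$. The link of a face $\sigma$ of $K$ is $\mathrm{link}_K(\sigma)=\{\tau\in K: \sigma\cap\tau=\emptyset,\ \sigma\cup\tau\in K\}$. $f_i(K)$ is the number of $i$-dimensional faces of $K$. The $F$-polynomial of $K$ is $F(K,x)=\sum_{j=0}^{\dim K+1} f_{j-1}(K)\left(\frac{x-1}{2}\right)^j$. $\partial(L)$ denotes the subcomplex of boundary faces of $L$, which is the boundary complex of the original $k$-simplex; $V(\cdot)$ denotes vertex set. A simplicial complex $K'$ is a generalized Tchebyshev triangulation of $K$ induced by $L$ if there is an ordered list $\sigma_1,\ldots,\sigma_m$ of the $k$-dimensional faces of $K$, listing each exactly once, bijections $\phi_{\sigma_i}:V(\partial(L))\to\sigma_i$, and simplicial complexes $K_0=K,K_1,\ldots,K_m=K'$ such that for each $i\geq 1$ the complex $K_i$ is obtained from $K_{i-1}$ as follows: take an isomorphic copy $L_i$ of $L$ in which each boundary vertex $w\in V(\partial(L))$ is identified with $\phi_{\sigma_i}(w)$ and the interior vertices are new vertices, and replace the family of faces $\{\sigma_i\cup\tau:\tau\in\mathrm{link}_{K_{i-1}}(\sigma_i)\}$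 by the family $\{\sigma'\cup\tau:\sigma'\in L_i,\ \tau\in\mathrm{link}_{K_{i-1}}(\sigma_i)\}$. All generalized Tchebyshev triangulations of a given $K$ induced by $L$ have the same $f$-vector, hence the same $F$-polynomial, and there is a unique linear map $T^L:\mathbb{R}[x]\to\mathbb{R}[x]$ with $T^L(F(K,x))=F(K',x)$ for every simplicial complex $K$ and every generalized Tchebyshev triangulation $K'$ of $K$ induced by $L$. One defines $T^L_n(x):=T^L(x^n)$. *)

(* Defs.v *)
From HB Require Import structures.
From mathcomp Require Import all_boot all_order all_algebra finmap.
From mathcomp Require Import boolp reals.

Set Implicit Arguments.
Unset Strict Implicit.
Unset Printing Implicit Defensive.

Import Order.TTheory GRing.Theory Num.Theory.

Local Open Scope fset_scope.
Local Open Scope ring_scope.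

Definition simplicial_complex (V : choiceType) (K : {fset {fset V}}) : Prop :=
  fset0 \in K /\ (forall s t : {fset V}, s \in K -> t `<=` s -> t \in K).

Definition vertices (V : choiceType) (K : {fset {fset V}}) : {fset V} :=
  \bigcup_(s <- K) s.

(* Faces are graded by cardinality: an i-dimensional face has i.+1 elements. *)
Definition faces_card (V : choiceType) (K : {fset {fset V}}) (j : nat) :
    {fset {fset V}} :=
  [fset s in K | #|` s| == j].

(* dim K + 1, which is a natural number even for K = {fset0} *)
Definition dimS (V : choiceType) (K : {fset {fset V}}) : nat :=
  (\max_(s <- K) #|` s|)%N.

Definition link (V : choiceType) (K : {fset {fset V}}) (s : {fset V}) :
    {fset {fset V}} :=
  [fset t in K | (s `&` t == fset0) && (s `|` t \in K)].

Definition Fpoly (R : realType) (V : choiceType) (K : {fset {fset V}}) :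
    {poly R} :=
  \sum_(j < (dimS K).+1) #|` faces_card K j|%:R *: (2^-1 *: ('X - 1)) ^+ j.

(* The k-simplex is the standard one, in barycentric coordinates. *)
Definition in_simplex (R : realType) (k : nat) (x : 'rV[R]_k.+1) : Prop :=
  (forall i, 0 <= x 0 i) /\ \sum_i x 0 i = 1.

Definition on_simplex_boundary (R : realType) (k : nat) (x : 'rV[R]_k.+1) :
    Prop :=
  in_simplex x /\ exists i, x 0 i = 0.

Definition in_hull (R : realType) (k : nat) (W : choiceType)
    (p : W -> 'rV[R]_k.+1) (s : {fset W}) (x : 'rV[R]_k.+1) : Prop :=
  exists a : W -> R,
    [/\ forall w, w \in s -> 0 <= a w,
        \sum_(w <- s) a w = 1
      & \sum_(w <- s) a w *: p w = x].

Definition affinely_independent (R : realType) (k : nat) (W : choiceType)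
    (p : W -> 'rV[R]_k.+1) (s : {fset W}) : Prop :=
  forall a : W -> R, \sum_(w <- s) a w = 0 -> \sum_(w <- s) a w *: p w = 0 ->
    forall w, w \in s -> a w = 0.

(* L, with its vertices placed by p, is a geometric simplicial complex whose
   underlying space is the k-simplex.  The hull of fset0 is empty, so the
   intersection condition also makes p injective on the vertices of L. *)
Definition simplex_triangulation (R : realType) (k : nat) (W : choiceType)
    (L : {fset {fset W}}) (p : W -> 'rV[R]_k.+1) : Prop :=
  [/\ simplicial_complex L,
      forall s, s \in L -> affinely_independent p s,
      forall s t, s \in L -> t \in L ->
        forall x, in_hull p s x -> in_hull p t x -> in_hull p (s `&` t) x
    & forall x, in_simplex x <-> exists2 s, s \in L & in_hull p s x].

Definition no_new_boundary_vertex (R : realType) (k : nat) (W : choiceType)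
    (L : {fset {fset W}}) (p : W -> 'rV[R]_k.+1) : Prop :=
  forall w, w \in vertices L -> on_simplex_boundary (p w) ->
    exists i, p w = delta_mx 0 i.

Definition boundary (R : realType) (k : nat) (W : choiceType)
    (L : {fset {fset W}}) (p : W -> 'rV[R]_k.+1) : {fset {fset W}} :=
  [fset s in L | `[< forall x, in_hull p s x -> on_simplex_boundary x >]].

(* The copy of L is its image under iota; the restriction of iota to
   vertices B, where B is the boundary of L, is the bijection phi_s onto s. *)
Definition replace_face (V W : choiceType) (L B : {fset {fset W}})
    (K : {fset {fset V}}) (s : {fset V}) (K' : {fset {fset V}}) : Prop :=
  exists iota : W -> V,
    [/\ {in vertices L &, injective iota},
        iota @` vertices B = s,
        forall w, w \in vertices L -> w \notin vertices B ->
          iota w \notin vertices K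
      & K' = (K `\` [fset s `|` t | t in link K s]) `|`
             [fset (iota @` s') `|` t | s' : {fset W} in L, t : {fset V} in link K s]].

Definition tchebyshev_triangulation (R : realType) (k : nat) (V W : choiceType)
    (L : {fset {fset W}}) (p : W -> 'rV[R]_k.+1) (K K' : {fset {fset V}}) :
    Prop :=
  exists (sigma : seq {fset V}) (Ks : nat -> {fset {fset V}}),
    [/\ uniq sigma /\ sigma =i faces_card K k.+1,
        forall i, (i <= size sigma)%N -> simplicial_complex (Ks i),
        Ks 0%N = K,
        Ks (size sigma) = K'
      & forall i, (i < size sigma)%N ->
          replace_face L (boundary L p)
            (Ks i) (nth fset0 sigma i) (Ks i.+1)].

(* The property characterizing the linear map T^L. *)
Definition tchebyshev_map (R : realType) (k : nat) (W : choiceType)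
    (L : {fset {fset W}}) (p : W -> 'rV[R]_k.+1)
    (T : {linear {poly R} -> {poly R}}) : Prop :=
  forall (V : choiceType) (K K' : {fset {fset V}}),
    simplicial_complex K -> tchebyshev_triangulation L p K K' ->
    T (Fpoly R K) = Fpoly R K'.

(* Main.v *)
Require Import Defs.
From HB Require Import structures.
From mathcomp Require Import all_boot all_order all_algebra finmap.
From mathcomp Require Import boolp reals.
From mathcomp Require Import zify ring lra.

Set Implicit Arguments.
Unset Strict Implicit.
Unset Printing Implicit Defensive.

Import Order.TTheory GRing.Theory Num.Theory.

Local Open Scope fset_scope.
Local Open Scope ring_scope.

(** The polynomial x^n is the F-polynomial of the boundary of the n-dimensional
    cross-polytope, because F-polynomials multiply under joins and two isolated
    points have F-polynomial x.  Hence T(x^n) is the F-polynomial of a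
    generalized Tchebyshev triangulation K' of that complex
    ([tchebyshev_map_monomial]).  With y = (x - 1) / 2 it is the sum of
    y^(number of vertices of s) over the faces s of K', so the degree is n, the
    value at 1 comes from the empty face, and the value is at least 1 for x >= 1.
    Parity then confines the real roots to (-1, 1).

    Parity is the content of the theorem.  It follows from the Eulerian property
    that the alternating sum over the faces containing a given face is always
    (-1)^n ([Fpoly_reciprocity]).  The cross-polytope has this property, and
    every replacement of a simplex by a copy of L preserves it
    ([eulerian_replacement]), provided that in L the alternating sum over the
    interior faces containing any given face is (-1)^(k+1), and that the
    boundary of L is the boundary of a simplex.

    The latter holds because no vertex of L other than the corners lies on the
    boundary ([boundary_face_proper]).  The former, [euler_interior_faces], is
    proved without homology.  A generic direction u partitions the faces of L
    which can be pushed along u inside the orthant into Boolean intervals, one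
    for each full-dimensional cone; a Boolean interval has alternating sum zero
    unless it is a point.  For the direction - v with v positive, the faces
    which can be pushed are the interior ones.  Of the intervals, cut down to
    the faces containing the given one, those reduced to a point belong to the
    cones that the opposite direction v assigns to the given face, and there is
    exactly one. *)

(** * Alternating sums over faces *)

Lemma eq_sum_seq (A : nmodType) (I : eqType) (r : seq I) (P Q : pred I)
    (F G : I -> A) :
  {in r, P =1 Q} -> (forall i, i \in r -> P i -> F i = G i) ->
  \sum_(i <- r | P i) F i = \sum_(i <- r | Q i) G i.
Proof.
move=> PQ FG; rewrite big_seq_cond [RHS]big_seq_cond.
by apply: eq_big => [i|i /andP[]]; [apply: andb_id2l; apply: PQ|apply: FG].
Qed.

Lemma sum_reindex (A : nmodType) (I J : eqType) (r : seq I) (r' : seq J)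
    (h : I -> J) (g : J -> A) :
  uniq r -> uniq r' -> {in r &, injective h} ->
  (forall y, reflect (exists2 x, x \in r & y = h x) (y \in r')) ->
  \sum_(y <- r') g y = \sum_(x <- r) g (h x).
Proof.
move=> Ur Ur' inj_h r'P; rewrite -(big_map h predT g) (perm_big (map h r)) //.
apply: uniq_perm => //; first by rewrite map_inj_in_uniq.
by move=> y; apply/r'P/mapP.
Qed.

Lemma linkP (V : choiceType) (K : {fset {fset V}}) (s t : {fset V}) :
  simplicial_complex K ->
  (t \in link K s) = (s `&` t == fset0) && (s `|` t \in K).
Proof.
move=> [_ dK]; rewrite !inE /= andb_idl // => /andP[_ /dK]; apply.
exact: fsubsetUr.
Qed.

Lemma fsetUD_sub (V : choiceType) (s t : {fset V}) :
  s `<=` t -> s `|` (t `\` s) = t.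
Proof.
move=> /fsubsetP st; apply/fsetP => x; rewrite !inE.
by case: (boolP (x \in s)) => //= /st.
Qed.

Lemma fsetD_link (V : choiceType) (K : {fset {fset V}}) (s t : {fset V}) :
  simplicial_complex K -> t \in K -> s `<=` t -> t `\` s \in link K s.
Proof.
move=> cK tK st; rewrite linkP // fsetUD_sub // tK andbT.
by apply/eqP/fsetP => x; rewrite !inE; case: (x \in s).
Qed.

Lemma fsetUDK_disjoint (V : choiceType) (s t : {fset V}) :
  s `&` t == fset0 -> (s `|` t) `\` s = t.
Proof.
move=> st; rewrite fsetDUl fsetDv fset0U; apply/fsetDidPl.
by rewrite fdisjoint_sym.
Qed.

Lemma sum_cofaces (A : nmodType) (V : choiceType) (K : {fset {fset V}})
    (s : {fset V}) (g : {fset V} -> A) :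
  simplicial_complex K ->
  \sum_(t <- K | s `<=` t) g t = \sum_(t <- link K s) g (s `|` t).
Proof.
move=> cK; rewrite -big_filter.
apply: sum_reindex; rewrite ?filter_uniq ?fset_uniq //.
  move=> t u; rewrite !linkP // => /andP[st _] /andP[su _].
  by move=> /(congr1 (fun x => x `\` s)); rewrite !fsetUDK_disjoint.
move=> t; rewrite mem_filter; apply: (iffP andP) => [[st tK]|[u]].
  by exists (t `\` s); rewrite ?fsetD_link ?fsetUD_sub.
by rewrite linkP // => /andP[_ suK] ->; rewrite fsubsetUl.
Qed.

Lemma simplicial_complex_fpowerset (V : choiceType) (M : {fset V}) :
  simplicial_complex (fpowerset M).
Proof.
split; first by rewrite fpowersetE fsub0set.
by move=> s t; rewrite !fpowersetE => sM ts; apply: fsubset_trans sM.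
Qed.

Lemma sum_faces_expr (A : comNzRingType) (V : choiceType) (M : {fset V}) (y : A) :
  \sum_(t <- fpowerset M) y ^+ #|` t| = (1 + y) ^+ #|` M|.
Proof.
elim/finSet_rect: M => M IH.
have [->|[x xM]] := fset_0Vmem M.
  by rewrite fpowerset0 big_seq_fset1 !cardfs0 !expr0.
have xD : x \notin M `\ x by rewrite !inE eqxx.
have cM : #|` M| = (#|` M `\ x|).+1 by rewrite (cardfsD1 x) xM.
rewrite cM exprS -(IH (M `\ x)) ?fproperD1 //.
rewrite (bigID (fun t : {fset V} => [fset x] `<=` t)) /= mulrDl mul1r addrC.
have cP := simplicial_complex_fpowerset M.
congr (_ + _).
  rewrite -big_filter; apply: perm_big; apply: uniq_perm.
  - by rewrite filter_uniq ?fset_uniq.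
  - exact: fset_uniq.
  by move=> t; rewrite mem_filter !fpowersetE fsub1set fsubsetD1 andbC.
rewrite sum_cofaces // mulr_sumr.
have -> : link (fpowerset M) [fset x] = fpowerset (M `\ x).
  apply/fsetP => t; rewrite linkP // !fpowersetE fsubUset fsub1set xM /=.
  by rewrite fsubsetD1 andbC fsetI_eq0 fdisjoint1X.
apply: eq_big_seq => t; rewrite fpowersetE fsubsetD1 => /andP[_ xt].
by rewrite cardfsU1 xt exprS.
Qed.

(** The cancellation behind every Euler characteristic below: the interval
    of faces between D and M is a Boolean lattice, whose alternating sum
    vanishes unless it is a single point. *)
Lemma alternating_sum_interval (V : choiceType) (D M : {fset V}) :
  D `<=` M ->
  \sum_(t <- fpowerset M | D `<=` t) (-1) ^+ #|` t| =
    (if D == M then (-1) ^+ #|` M| else 0) :> int.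
Proof.
move=> DM; have cP := simplicial_complex_fpowerset M.
rewrite sum_cofaces //.
have -> : link (fpowerset M) D = fpowerset (M `\` D).
  apply/fsetP => t; rewrite linkP // !fpowersetE fsubUset DM /=.
  by rewrite fsubsetD fsetI_eq0 fdisjoint_sym andbC.
transitivity (\sum_(t <- fpowerset (M `\` D))
    (-1) ^+ #|` D| * (-1) ^+ #|` t| : int).
  apply: eq_big_seq => t; rewrite fpowersetE fsubsetD => /andP[_ dt].
  move: dt; rewrite fdisjoint_sym => /eqP dt.
  by rewrite -exprD cardfsU dt cardfs0 subn0.
rewrite -mulr_sumr sum_faces_expr subrr expr0n cardfs_eq0 fsetD_eq0.
have [->|nDM] := eqVneq D M; first by rewrite fsubset_refl mulr1.
rewrite (_ : (M `<=` D) = false) ?mulr0 //; apply: contraNF nDM => MD.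
by rewrite eqEfsubset DM.
Qed.

(** * Replacing a simplex in an Eulerian complex *)

(** All that the argument needs to know about the triangulated simplex L with
    boundary B.  By [eb_boundary] and [eb_card] the complex B consists of all
    the proper subsets of one set of [k.+1] vertices.  [eb_euler] says that
    every face has the same alternating number of interior cofaces, as for a
    ball: for an interior face the link is a sphere, and for a boundary face it
    is a ball whose interior faces are counted. *)
Record eulerian_ball (k : nat) (W : choiceType) (L B : {fset {fset W}}) :
    Prop := EulerianBall {
  eb_complex : simplicial_complex L;
  eb_boundary : forall a, (a \in B) = (a `<` vertices B);
  eb_sub : B `<=` L;
  eb_card : #|` vertices B| = k.+1;
  eb_dim : forall s, s \in L -> (#|` s| <= k.+1)%N;
  eb_facet : exists2 M, M \in L & #|` M| = k.+1;
  eb_euler : forall a, a \in L ->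
    \sum_(t <- L | (t \notin B) && (a `<=` t)) (-1) ^+ #|` t| = (-1) ^+ k.+1 :> int
}.

(** For a face s, the sum is, up to sign, the reduced Euler characteristic of
    its link; complexes satisfying this behave numerically as spheres of
    dimension n - 1. *)
Definition eulerian (V : choiceType) (n : nat) (K : {fset {fset V}}) : Prop :=
  forall s, s \in K ->
    \sum_(t <- K | s `<=` t) (-1) ^+ #|` t| = (-1) ^+ n :> int.

(** The last two clauses fix the dimension, hence the degree of the
    F-polynomial. *)
Definition eulerian_complex (V : choiceType) (n : nat) (K : {fset {fset V}}) :
    Prop :=
  [/\ simplicial_complex K, eulerian n K,
      forall s, s \in K -> (#|` s| <= n)%N
    & exists2 s, s \in K & #|` s| = n].

Lemma verticesP (V : choiceType) (K : {fset {fset V}}) (x : V) :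
  reflect (exists2 s, s \in K & x \in s) (x \in vertices K).
Proof.
apply: (iffP (bigfcupP _ _ _ _)) => [[s]|[s sK xs]].
  by rewrite andbT; exists s.
by exists s; rewrite ?andbT.
Qed.

Lemma sub_vertices (V : choiceType) (K : {fset {fset V}}) (s : {fset V}) :
  s \in K -> s `<=` vertices K.
Proof. by move=> sK; apply/fsubsetP => x xs; apply/verticesP; exists s. Qed.

Section Replacement.

Variables (V W : choiceType) (k : nat) (L B : {fset {fset W}}).
Variables (K : {fset {fset V}}) (sg : {fset V}) (iota : W -> V).
Hypothesis LB : eulerian_ball k L B.
Hypothesis cK : simplicial_complex K.
Hypothesis inj_iota : {in vertices L &, injective iota}.
Hypothesis iotaB : iota @` vertices B = sg.
Hypothesis iotaN :
  forall w, w \in vertices L -> w \notin vertices B -> iota w \notin vertices K.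

Let K' := (K `\` [fset sg `|` t | t in link K sg]) `|`
  [fset (iota @` s') `|` t | s' : {fset W} in L, t : {fset V} in link K sg].

Lemma card_replaced : #|` sg| = k.+1.
Proof.
rewrite -iotaB card_in_imfset ?(eb_card LB) // => x y xB yB.
apply: inj_iota; apply/verticesP.
  by case/verticesP: xB => s /(fsubsetP (eb_sub LB)); exists s.
by case/verticesP: yB => s /(fsubsetP (eb_sub LB)); exists s.
Qed.

Lemma vertices_boundary_sub : vertices B `<=` vertices L.
Proof.
apply/fsubsetP => x /verticesP[s /(fsubsetP (eb_sub LB)) sL xs].
by apply/verticesP; exists s.
Qed.

Lemma coface_mem t : (t \in [fset sg `|` t | t in link K sg]) =
  (t \in K) && (sg `<=` t).
Proof.
apply/imfsetP/andP => [[u /=]|[tK st]].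
  by rewrite linkP // => /andP[_ uK] ->; rewrite fsubsetUl.
by exists (t `\` sg); rewrite /= ?fsetD_link ?fsetUD_sub.
Qed.

(** The whole set of boundary vertices is an interior face when L is the
    trivial triangulation, and the dichotomy lets that case be treated together
    with the others. *)
Lemma interior_faceP a : a \in L ->
  reflect (a = vertices B \/ exists2 w, w \in a & w \notin vertices B)
          (a \notin B).
Proof.
move=> aL; rewrite (eb_boundary LB); apply: (iffP idP); last first.
  case=> [->|[w wa]]; first exact: fproper_irrefl.
  by apply: contra => /fproper_sub/fsubsetP; apply.
have [aB|/fsubsetPn[w wa wB] _] := boolP (a `<=` vertices B); last by right; exists w.
by rewrite fproperEneq aB andbT negbK => /eqP; left.
Qed.

Lemma iota_inB w : w \in vertices L -> (iota w \in sg) = (w \in vertices B).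
Proof.
move=> wL; rewrite -iotaB; apply/imfsetP/idP => [[x /= xB]|wB]; last by exists w.
by move/(inj_iota wL (fsubsetP vertices_boundary_sub _ xB)) ->.
Qed.

Lemma link_iota t w : t \in link K sg -> w \in vertices L -> iota w \notin t.
Proof.
move=> tl wL; apply/negP => it; have [wB|wB] := boolP (w \in vertices B).
  move: tl; rewrite linkP // => /andP[/eqP/fsetP/(_ (iota w))].
  by rewrite !inE iota_inB // wB it.
suff : iota w \in vertices K by apply/negP/iotaN.
apply/verticesP; exists t => //.
by move: tl; rewrite !inE => /andP[].
Qed.

Lemma imfset_iota_sub a s : a \in L -> s \in L ->
  (iota @` a `<=` iota @` s) = (a `<=` s).
Proof.
move=> /sub_vertices/fsubsetP aL /sub_vertices/fsubsetP sL.
apply/idP/idP => [/fsubsetP h|]; last first.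
  move=> /fsubsetP h; apply/fsubsetP => x /imfsetP[w /= wa ->].
  by apply/imfsetP; exists w => //=; apply: h.
apply/fsubsetP => w wa.
have /h/imfsetP[x /= xs] : iota w \in iota @` a by apply/imfsetP; exists w.
by move/(inj_iota (aL _ wa) (sL _ xs)) ->.
Qed.

Lemma card_iota s : s \in L -> #|` iota @` s| = #|` s|.
Proof.
move=> /sub_vertices/fsubsetP sL.
by rewrite card_in_imfset // => x y /sL xL /sL; apply: inj_iota.
Qed.

Lemma disjoint_iota s t : s \in L -> t \in link K sg ->
  (iota @` s) `&` t = fset0.
Proof.
move=> /sub_vertices/fsubsetP sL tl; apply/eqP; rewrite fsetI_eq0.
by apply/fdisjointP => x /imfsetP[w /= /sL wL ->]; apply: link_iota.
Qed.

Lemma card_new_face s t : s \in L -> t \in link K sg ->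
  #|` iota @` s `|` t| = (#|` s| + #|` t|)%N.
Proof. by move=> sL tl; rewrite cardfsU disjoint_iota // cardfs0 subn0 card_iota. Qed.

(** A new face determines both of its parts, since the copy of L meets the
    link of sg in no vertex.  This makes the family of new faces a product. *)
Lemma new_face_sub a b s t : a \in L -> b \in link K sg -> s \in L ->
  t \in link K sg ->
  (iota @` a `|` b `<=` iota @` s `|` t) = (a `<=` s) && (b `<=` t).
Proof.
move=> aL bl sL tl; apply/idP/andP => [/fsubsetP h|[as_ bt]]; last first.
  by apply: fsetUSS => //; rewrite imfset_iota_sub.
split.
  rewrite -imfset_iota_sub //; apply/fsubsetP => x xa.
  have := h x; rewrite !inE xa => /(_ isT)/orP[//|xt].
  case/imfsetP: xa xt => w /= wa -> /negPn; rewrite link_iota //.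
  exact: fsubsetP (sub_vertices aL) _ wa.
apply/fsubsetP => x xb; have := h x; rewrite !inE xb orbT => /(_ isT)/orP[|//].
case/imfsetP=> w /= ws xE; move: xb; rewrite xE (negPf (link_iota _ _)) //.
exact: fsubsetP (sub_vertices sL) _ ws.
Qed.

Lemma new_faceP x :
  reflect (exists s t, [/\ s \in L, t \in link K sg & x = iota @` s `|` t])
    (x \in [fset (iota @` s') `|` t | s' : {fset W} in L, t : {fset V} in link K sg]).
Proof.
apply: (iffP (imfset2P _ _ _ _ _)) => [[s /= sL [t /= tl ->]]|[s [t [sL tl ->]]]].
  by exists s, t.
by exists s => //; exists t.
Qed.

Lemma new_boundary_face a t : a \in B -> t \in link K sg ->
  (iota @` a `|` t \in K) /\ ~~ (sg `<=` iota @` a `|` t).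
Proof.
move=> aB tl; have aL := fsubsetP (eb_sub LB) _ aB.
move: (aB); rewrite (eb_boundary LB) => /[dup] /fproper_sub/fsubsetP asub.
rewrite fproperE => /andP[_ /fsubsetPn[w wB wa]].
have wL := fsubsetP vertices_boundary_sub _ wB.
split; last first.
  apply/fsubsetPn; exists (iota w); first by rewrite iota_inB.
  rewrite !inE (negPf (link_iota tl wL)) orbF; apply: contra wa => /imfsetP[x /= xa].
  by move/(inj_iota wL (fsubsetP (sub_vertices aL) _ xa)) ->.
move: tl; rewrite linkP // => /andP[_ /(proj2 cK)]; apply.
apply: fsetSU; apply/fsubsetP => x /imfsetP[y /= /asub yB ->].
by rewrite -iotaB; apply/imfsetP; exists y.
Qed.

Lemma new_interior_face a t : a \in L -> a \notin B -> t \in link K sg ->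
  ~~ ((iota @` a `|` t \in K) && ~~ (sg `<=` iota @` a `|` t)).
Proof.
move=> aL /(interior_faceP aL)[->|[w wa wB]] tl.
  by rewrite iotaB fsubsetUl andbF.
apply/nandP; left; apply/negP => /sub_vertices/fsubsetP/(_ (iota w)) h.
have wL := fsubsetP (sub_vertices aL) _ wa.
apply: (negP (iotaN wL wB)); apply: h; rewrite inE.
by apply/orP; left; apply/imfsetP; exists w.
Qed.

(** The two families in the definition of K' overlap: a face of L on the
    boundary only reproduces old faces.  With interior faces of L alone the
    union becomes disjoint, which is what summation over K' requires. *)
Lemma mem_replacement x : reflect
  ((x \in K /\ ~~ (sg `<=` x)) \/
   exists s t, [/\ s \in L, s \notin B, t \in link K sg & x = iota @` s `|` t])
  (x \in K').
Proof.
rewrite /K' in_fsetU in_fsetD coface_mem; apply: (iffP orP).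
  case=> [/andP[h xK]|/new_faceP[s [t [sL tl ->]]]].
    by left; move: h; rewrite xK.
  have [sB|sB] := boolP (s \in B); last by right; exists s, t.
  by left; apply: new_boundary_face.
case=> [[xK h]|[s [t [sL sB tl xE]]]]; first by left; rewrite xK h.
by right; apply/new_faceP; exists s, t.
Qed.

Lemma sum_replacement (A : nmodType) (g : {fset V} -> A) :
  \sum_(x <- K') g x = \sum_(x <- K | ~~ (sg `<=` x)) g x +
    \sum_(s <- L | s \notin B) \sum_(t <- link K sg) g (iota @` s `|` t).
Proof.
set r1 := [seq x <- K | ~~ (sg `<=` x)].
pose nf (s : {fset W}) (t : {fset V}) := iota @` s `|` t.
set r2 := [seq nf s t | s <- [seq s <- L | s \notin B], t <- link K sg].
have -> : \sum_(x <- K') g x = \sum_(x <- r1 ++ r2) g x.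
  apply: perm_big; apply: uniq_perm; first exact: fset_uniq.
    rewrite cat_uniq filter_uniq ?fset_uniq //=; apply/andP; split.
      apply/hasPn => x /allpairsP[[s t] /= [+ tl ->]].
      rewrite !mem_filter => /andP[sB sL]; rewrite andbC.
      exact: new_interior_face.
    apply: allpairs_uniq; rewrite ?filter_uniq ?fset_uniq //.
    move=> [s t] [s' t'] /allpairsP[[s1 t1] /= [+ + [-> ->]]].
    rewrite mem_filter => /andP[_ sL] tl.
    case/allpairsP=> [[s2 t2] /= [+ + [-> ->]]].
    rewrite mem_filter => /andP[_ s'L] t'l /eqP; rewrite eqEfsubset.
    rewrite /= /nf !new_face_sub // => /andP[/andP[a b] /andP[c d]].
    by congr (_, _); apply/eqP; rewrite eqEfsubset ?a ?b ?c ?d.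
  move=> x; rewrite mem_cat mem_filter; apply/mem_replacement/orP.
    case=> [[xK h]|[s [t [sL sB tl xE]]]]; first by left; rewrite h.
    right; apply/allpairsP; exists (s, t); rewrite mem_filter sB.
    by split.
  case=> [/andP[]|/allpairsP[[s t] /= [+ tl xE]]]; first by left.
  by rewrite mem_filter => /andP[sB sL]; right; exists s, t.
rewrite big_cat /= big_filter; congr (_ + _).
by rewrite big_allpairs_dep /= big_filter.
Qed.

Lemma sum_old_cofaces (s : {fset V}) :
  \sum_(x <- K | (sg `<=` x) && (s `<=` x)) (-1) ^+ #|` x| =
  (-1) ^+ k.+1 * \sum_(t <- link K sg | s `\` sg `<=` t) (-1) ^+ #|` t| :> int.
Proof.
rewrite big_mkcondr sum_cofaces // mulr_sumr [RHS]big_mkcond /=.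
apply: eq_big_seq => t; rewrite linkP // => /andP[/eqP st _].
by rewrite fsubDset; case: ifP; rewrite // cardfsU st cardfs0 subn0 card_replaced exprD.
Qed.

Lemma sum_new_cofaces (a : {fset W}) (b : {fset V}) : a \in L ->
  \sum_(s <- L | s \notin B)
    \sum_(t <- link K sg | (a `<=` s) && (b `<=` t)) (-1) ^+ #|` iota @` s `|` t| =
  (-1) ^+ k.+1 * \sum_(t <- link K sg | b `<=` t) (-1) ^+ #|` t| :> int.
Proof.
move=> aL; rewrite -(eb_euler LB aL) mulr_suml big_mkcondr /=.
rewrite big_seq_cond [RHS]big_seq_cond; apply: eq_bigr => s /andP[sL _].
case: ifP => _ /=; last by rewrite big_pred0.
rewrite mulr_sumr big_seq_cond [RHS]big_seq_cond.
by apply: eq_bigr => t /andP[tl _]; rewrite card_new_face // exprD.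
Qed.

(** Cofaces of s in K' are old ones avoiding sg, and new ones.  For an old
    face s the new cofaces contribute the product of an alternating sum over
    interior faces of L, which is [(-1) ^+ k.+1] by [eb_euler], and one over
    the link; that product is exactly what the removed cofaces contributed.
    For a new face only new cofaces exist, and the product is the sum over the
    cofaces in K of sg together with the part of s in the link. *)
Lemma eulerian_replacement n : eulerian n K -> eulerian n K'.
Proof.
move=> eK s sK'; rewrite big_mkcond sum_replacement /=.
rewrite (eq_bigr (fun u => \sum_(t <- link K sg | s `<=` iota @` u `|` t)
  (-1) ^+ #|` iota @` u `|` t| : int)); last by move=> u _; rewrite -big_mkcond.
case/mem_replacement: sK' => [[sK nsg]|[a [b [aL aB bl ->]]]].
  rewrite -(eK s sK) [RHS](bigID (fun x => sg `<=` x)) /= addrC -big_mkcondr.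
  congr (_ + _); first by apply: eq_bigl => x; rewrite andbC.
  under [RHS]eq_bigl do rewrite andbC.
  rewrite sum_old_cofaces.
  (* The face of L lying over s: a proper face of the simplex, as sg is not
     contained in s. *)
  pose a := [fset w in vertices B | iota w \in s].
  have aB : a \in B.
    rewrite (eb_boundary LB) fproperE; apply/andP; split.
      by apply/fsubsetP => w; rewrite !inE => /andP[].
    case/fsubsetPn: nsg => x; rewrite -iotaB => /imfsetP[w /= wB ->] ws.
    by apply/fsubsetPn; exists w; rewrite // !inE wB.
  rewrite -(@sum_new_cofaces a) ?(fsubsetP (eb_sub LB) _ aB) //.
  apply: (@eq_sum_seq int {fset W}) => // u uL _.
  apply: (@eq_sum_seq int {fset V}) => // t tl.
  rewrite /=; have uv := fsubsetP (sub_vertices uL).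
  apply/fsubsetP/andP => [h|[/fsubsetP h1 /fsubsetP h2] x xs].
    split; apply/fsubsetP => w; rewrite !inE.
      case/andP=> wB ws; have wL := fsubsetP vertices_boundary_sub _ wB.
      have := h _ ws; rewrite inE (negPf (link_iota tl wL)) orbF.
      by case/imfsetP=> w' /= w'u /(inj_iota wL (uv _ w'u)) ->.
    rename w into x; case/andP=> xsg xs; have := h _ xs; rewrite inE => /orP[|//].
    case/imfsetP=> w /= wu xE; move: xsg; rewrite xE iota_inB ?uv // => wB.
    by case/negP: (iotaN (uv _ wu) wB); apply/verticesP; exists s; rewrite -?xE.
  rewrite inE; have [xsg|xsg] := boolP (x \in sg); last first.
    by rewrite [x \in t]h2 ?orbT // inE xsg.
  move: (xsg); rewrite -iotaB => /imfsetP[w /= wB xE].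
  apply/orP; left; apply/imfsetP; exists w => //=.
  by apply: h1; rewrite !inE wB -xE.
rewrite -big_mkcondr big_seq_cond big_pred0 ?add0r; last first.
  move=> x; apply: contraNF (new_interior_face aL aB bl).
  case/and3P=> xK nsg h; rewrite (proj2 cK _ _ xK h) /=.
  by apply: contra nsg => /fsubset_trans; apply.
have bK : sg `|` b \in K by move: bl; rewrite linkP // => /andP[].
transitivity ((-1) ^+ k.+1 * \sum_(t <- link K sg | b `<=` t) (-1) ^+ #|` t| : int).
  rewrite -(sum_new_cofaces b aL).
  apply: (@eq_sum_seq int {fset W}) => // u uL _.
  apply: (@eq_sum_seq int {fset V}) => // t tl.
  by rewrite new_face_sub.
rewrite -(eK _ bK).
have := sum_old_cofaces (sg `|` b); rewrite fsetUDK_disjoint; last first.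
  by move: bl; rewrite linkP // => /andP[].
move=> <-; apply: eq_bigl => x; rewrite andb_idl //.
exact: fsubset_trans (fsubsetUl _ _).
Qed.

Lemma simplicial_complex_replacement : simplicial_complex K'.
Proof.
have mem2 s t : s \in L -> t \in link K sg -> iota @` s `|` t \in K'.
  move=> sL tl; apply/mem_replacement.
  have [sB|sB] := boolP (s \in B); last by right; exists s, t.
  by left; apply: new_boundary_face.
split.
  apply/mem_replacement; left; split; first by case: cK.
  by rewrite fsubset0 -cardfs_eq0 card_replaced.
move=> s u /mem_replacement[[sK nsg] us|[a [b [aL aB bl ->]]] /fsubsetP us].
  apply/mem_replacement; left; split; first exact: (proj2 cK) us.
  by apply: contra nsg => /fsubset_trans; apply.
pose a' := [fset w in a | iota w \in u].
have -> : u = iota @` a' `|` (u `&` b).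
  apply/fsetP => x; rewrite !inE; apply/idP/orP => [xu|[/imfsetP[w /=]|/andP[]//]].
    have := us x xu; rewrite inE => /orP[xa|->]; last by right; rewrite xu.
    left; case/imfsetP: xa xu => w /= wa -> wu; apply/imfsetP; exists w => //=.
    by rewrite !inE wa.
  by rewrite !inE => /andP[_ ?] ->.
apply: mem2.
  by apply: (proj2 (eb_complex LB)) aL _; apply/fsubsetP => w; rewrite !inE => /andP[].
move: bl; rewrite !linkP // => /andP[sb sbK].
apply/andP; split.
  by move: sb; rewrite !fsetI_eq0; apply: fdisjointWr; apply: fsubsetIr.
by apply: (proj2 cK) sbK _; apply: fsetUS; apply: fsubsetIr.
Qed.

Lemma eulerian_complex_replacement n :
  eulerian_complex n K -> eulerian_complex n K'.
Proof.
case=> _ eK dK [f fK fn]; split.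
- exact: simplicial_complex_replacement.
- exact: eulerian_replacement.
- move=> s /mem_replacement[[sK _]|[a [b [aL _ bl ->]]]]; first exact: dK.
  rewrite card_new_face //; move: bl; rewrite linkP // => /andP[/eqP sb /dK].
  rewrite cardfsU sb cardfs0 subn0 card_replaced.
  by apply: leq_trans; rewrite leq_add2r (eb_dim LB).
have [sf|sf] := boolP (sg `<=` f); last first.
  by exists f => //; apply/mem_replacement; left.
have [M ML cM] := eb_facet LB.
have MB : M \notin B.
  rewrite (eb_boundary LB); apply/negP => /fproper_ltn_card.
  by rewrite cM (eb_card LB) ltnn.
have fl : f `\` sg \in link K sg by apply: fsetD_link.
exists (iota @` M `|` (f `\` sg)).
  by apply/mem_replacement; right; exists M, (f `\` sg).
rewrite card_new_face // cM cardfsDS // fn card_replaced subnKC //.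
by rewrite -fn -card_replaced fsubset_leq_card.
Qed.

End Replacement.

Lemma replace_face_eulerian_complex (V W : choiceType) k
    (L B : {fset {fset W}}) (K K' : {fset {fset V}}) sg n :
  eulerian_ball k L B -> eulerian_complex n K ->
  replace_face L B K sg K' -> eulerian_complex n K'.
Proof.
move=> LB eK [iota [inj_iota iotaB iotaN ->]].
have [cK _ _ _] := eK.
exact: (eulerian_complex_replacement LB cK inj_iota iotaB iotaN eK).
Qed.

(** * Existence of replacements *)

(** Working with vertices in nat leaves room for new vertices: they are put
    above every number already in use. *)
Lemma exists_replace_face (W : choiceType) k (L B : {fset {fset W}})
    (K : {fset {fset nat}}) (sg : {fset nat}) :
  eulerian_ball k L B -> #|` sg| = k.+1 ->
  exists K', replace_face L B K sg K'.
Proof.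
move=> LB csg.
pose N := (\max_(x <- vertices K) x + \max_(x <- sg) x).+1.
pose iota w := if w \in vertices B then nth 0%N sg (index w (vertices B))
               else (N + index w (vertices L))%N.
have sizeB : size (vertices B) = size sg by rewrite (eb_card LB) csg.
have iota_sg w : w \in vertices B -> iota w \in sg.
  by rewrite /iota => wB; rewrite wB mem_nth // -sizeB index_mem.
have ltN x : (x \in vertices K) || (x \in sg) -> (x < N)%N.
  move=> h; rewrite /N ltnS; case/orP: h => h.
    by apply: leq_trans (leq_addr _ _); apply: leq_bigmax_seq.
  by apply: leq_trans (leq_addl _ _); apply: leq_bigmax_seq.
have iotaN w : w \notin vertices B -> (N <= iota w)%N.
  by rewrite /iota => /negPf ->; rewrite leq_addr.
eexists; exists iota; split; last by reflexivity.
- move=> w w' wL w'L; have [wB|wB] := boolP (w \in vertices B);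
    have [w'B|w'B] := boolP (w' \in vertices B).
  + rewrite /iota wB w'B => /eqP; rewrite nth_uniq ?fset_uniq -?sizeB ?index_mem //.
    by move/eqP/index_inj; apply.
  + move=> e; have := ltN (iota w); rewrite iota_sg // orbT => /(_ isT).
    by rewrite e ltnNge iotaN.
  + move=> e; have := ltN (iota w'); rewrite iota_sg // orbT => /(_ isT).
    by rewrite -e ltnNge iotaN.
  + rewrite /iota (negPf wB) (negPf w'B) => /addnI.
    by move/index_inj; apply.
- apply/fsetP => x; apply/imfsetP/idP => [[w /= wB ->]|xs]; first exact: iota_sg.
  have xi : (index x sg < size (vertices B))%N by rewrite sizeB index_mem.
  have [w0 _] : exists w0 : W, True.
    by case: (enum_fset (vertices B)) xi => [//|w0 r] _; exists w0.
  exists (nth w0 (vertices B) (index x sg)); first by rewrite /= mem_nth.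
  by rewrite /iota mem_nth // index_uniq ?fset_uniq // nth_index.
move=> w wL wB; apply/negP => h; have := iotaN _ wB; rewrite leqNgt.
by rewrite ltN ?h.
Qed.

(** A member of sg that is no longer a face when its turn comes has an empty
    link, and its replacement changes nothing; so tracking cardinalities is
    enough for the induction. *)
Lemma exists_replacement_sequence (W : choiceType) k (L B : {fset {fset W}}) n
    (sg : seq {fset nat}) (K : {fset {fset nat}}) :
  eulerian_ball k L B -> eulerian_complex n K ->
  (forall s, s \in sg -> #|` s| = k.+1) ->
  exists Ks : nat -> {fset {fset nat}},
    [/\ Ks 0%N = K,
        forall i, (i <= size sg)%N -> eulerian_complex n (Ks i)
      & forall i, (i < size sg)%N ->
          replace_face L B (Ks i) (nth fset0 sg i) (Ks i.+1)].
Proof.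
move=> LB; elim: sg K => [|s sg IH] K eK csg.
  by exists (fun=> K); split.
have [K1 rK1] := exists_replace_face K LB (csg s (mem_head _ _)).
have eK1 := replace_face_eulerian_complex LB eK rK1.
have [|Ks [Ks0 eKs rKs]] := IH _ eK1.
  by move=> u us; apply: csg; rewrite inE us orbT.
exists (fun i => if i is j.+1 then Ks j else K); split=> // [[|i]|[|i]] //=.
- exact: eKs.
- by rewrite Ks0.
- exact: rKs.
Qed.

(** * The F-polynomial of an Eulerian complex *)

Section FPolynomial.

Variable R : realType.

Definition face_weight : {poly R} := 2^-1 *: ('X - 1).

Lemma Fpoly_sum_faces (V : choiceType) (K : {fset {fset V}}) :
  Fpoly R K = \sum_(s <- K) face_weight ^+ #|` s|.
Proof.
have dimP s : s \in K -> (#|` s| < (dimS K).+1)%N.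
  by move=> sK; rewrite ltnS /dimS;
    exact: (@leq_bigmax_seq {fset V} (enum_fset K) xpredT (fun s => #|` s|) s).
rewrite /Fpoly -/face_weight.
transitivity (\sum_(j < (dimS K).+1) \sum_(s <- K | #|` s| == j) face_weight ^+ j).
  apply: eq_bigr => j _; rewrite big_const_seq iter_addr_0 scaler_nat.
  congr (_ *+ _); rewrite -size_filter; apply: perm_size; apply: uniq_perm.
  - exact: fset_uniq.
  - by rewrite filter_uniq ?fset_uniq.
  by move=> s; rewrite mem_filter !inE /= andbC.
rewrite (exchange_big_dep predT) //=; apply: eq_big_seq => s sK.
rewrite (bigD1 (Ordinal (dimP s sK))) //= big1 ?addr0 // => j /andP[/eqP sj].
by rewrite -val_eqE /= sj eqxx.
Qed.

Lemma size_face_weight_exp j : size (face_weight ^+ j) = j.+1.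
Proof.
have s2 : size face_weight = 2%N by rewrite size_scale ?invr_eq0 ?pnatr_eq0 // size_XsubC.
by rewrite polySpred ?expf_neq0 -?size_poly_eq0 ?s2 // size_exp s2 mul1n.
Qed.

Lemma coef_face_weight_exp j : (face_weight ^+ j)`_j = 2^-1 ^+ j.
Proof.
have := lead_coef_exp face_weight j; rewrite lead_coefE size_face_weight_exp => ->.
by rewrite lead_coefZ lead_coefXsubC mulr1.
Qed.

Lemma size_Fpoly (V : choiceType) (K : {fset {fset V}}) n :
  eulerian_complex n K -> size (Fpoly R K) = n.+1.
Proof.
case=> _ _ dK [f fK fn]; rewrite Fpoly_sum_faces; apply/eqP; rewrite eqn_leq.
apply/andP; split.
  rewrite big_seq; elim/big_ind: _ => [|p q sp sq|s sK].
  - by rewrite size_poly0.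
  - by apply: leq_trans (size_polyD _ _) _; rewrite geq_max sp.
  - by rewrite size_face_weight_exp ltnS dK.
suff : 0 < (\sum_(s <- K) face_weight ^+ #|` s|)`_n.
  by rewrite ltNge; apply: contraNltn => h; rewrite nth_default.
have ge0 s : s \in K -> 0 <= (face_weight ^+ #|` s|)`_n.
  move=> /dK; rewrite leq_eqVlt => /orP[/eqP <-|h].
    by rewrite coef_face_weight_exp exprn_ge0 // invr_ge0.
  by rewrite nth_default ?size_face_weight_exp.
rewrite coef_sum big_seq (big_rem f) //= fK; apply: ltr_wpDr.
  by rewrite sumr_ge0.
by rewrite -fn coef_face_weight_exp exprn_gt0 // invr_gt0.
Qed.

Lemma Fpoly_ge1 (V : choiceType) (K : {fset {fset V}}) (x : R) :
  fset0 \in K -> 1 <= x -> 1 <= (Fpoly R K).[x].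
Proof.
move=> K0 x1; rewrite Fpoly_sum_faces horner_sum (big_rem fset0) //=.
rewrite expr0 hornerC lerDl sumr_ge0 // => s _.
by rewrite horner_exp !hornerE exprn_ge0 // mulr_ge0 ?invr_ge0 // subr_ge0.
Qed.

Lemma Fpoly_at1 (V : choiceType) (K : {fset {fset V}}) :
  fset0 \in K -> (Fpoly R K).[1] = 1.
Proof.
move=> K0; rewrite Fpoly_sum_faces horner_sum (big_rem fset0) //=.
rewrite expr0 hornerC big_seq big1 ?addr0 // => s.
rewrite mem_rem_uniq ?fset_uniq // inE => /andP[s0 _].
by rewrite horner_exp !hornerE subrr mulr0 expr0n cardfs_eq0 (negPf s0).
Qed.

(** Substituting - x for x turns (x - 1) / 2 into - (1 + (x - 1) / 2).  Each
    face t then contributes [(-1) ^+ #|` t|] times the sum over its subfaces s,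
    and after exchanging the sums the coefficient of s is the alternating sum
    over its cofaces. *)
Lemma Fpoly_reciprocity (V : choiceType) (K : {fset {fset V}}) n :
  eulerian_complex n K -> Fpoly R K \Po (- 'X) = (-1) ^+ n *: Fpoly R K.
Proof.
case=> [[K0 dK] eK _ _]; rewrite Fpoly_sum_faces raddf_sum /=.
have flip : face_weight \Po (- 'X) = - (1 + face_weight).
  rewrite /face_weight comp_polyZ comp_polyB comp_polyX comp_polyC -!mul_polyC.
  set c := 2^-1%:P.
  have h2 : c * 2 = 1 by rewrite /c -polyC_natr -polyCM mulVf ?pnatr_eq0.
  have -> : - (1 + c * ('X - 1)) = c * (- 'X - 1) + (c * 2 - 1) by ring.
  by rewrite h2 subrr addr0.
transitivity (\sum_(t <- K) \sum_(s <- K | s `<=` t)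
    (-1) ^+ #|` t| * face_weight ^+ #|` s|).
  apply: eq_big_seq => t tK.
  rewrite rmorphXn /= flip [LHS]exprNn -(sum_faces_expr t face_weight) mulr_sumr.
  rewrite -big_filter; apply: perm_big; apply: uniq_perm.
  - exact: fset_uniq.
  - by rewrite filter_uniq ?fset_uniq.
  by move=> s; rewrite mem_filter fpowersetE andb_idr // => /(dK _ _ tK).
rewrite (exchange_big_dep predT) //= scaler_sumr; apply: eq_big_seq => s sK.
rewrite -mulr_suml -mul_polyC; congr (_ * _).
have := congr1 (fun m : int => m%:~R : {poly R}) (eK s sK).
rewrite rmorphXn rmorphN1 rmorph_sum /= => e.
by rewrite rmorphXn rmorphN1 -e; apply: eq_bigr => t _; rewrite rmorphXn rmorphN1.
Qed.

End FPolynomial.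

(** * Cross-polytopes *)

Section Suspension.

Variables (V : choiceType) (n : nat) (K : {fset {fset V}}) (a b : V).
Hypotheses (eK : eulerian_complex n K).
Hypotheses (ab : a != b) (aK : a \notin vertices K) (bK : b \notin vertices K).

Definition suspension : {fset {fset V}} :=
  K `|` ([fset a |` s | s in K] `|` [fset b |` s | s in K]).

Lemma apex_notin c s : c \notin vertices K -> s \in K -> c \notin s.
Proof. by move=> cK sK; apply: contra cK => cs; apply/verticesP; exists s. Qed.

Lemma mem_coneP c x : c \notin vertices K ->
  (x \in [fset c |` s | s in K]) = (c \in x) && (x `\ c \in K).
Proof.
move=> cK; apply/imfsetP/andP => [[s /= sK ->]|[cx xK]].
  by rewrite fset1U1 fsetU1K ?(apex_notin cK).
by exists (x `\ c); rewrite //= fsetD1K.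
Qed.

Lemma sum_suspension (A : nmodType) (g : {fset V} -> A) :
  \sum_(x <- suspension) g x =
  \sum_(s <- K) (g s + (g (a |` s) + g (b |` s))).
Proof.
rewrite !big_split /=.
have inj c : c \notin vertices K -> {in K &, injective (fun s => c |` s)}.
  move=> cK s t sK tK /= e.
  by rewrite -(fsetU1K (apex_notin cK sK)) e fsetU1K ?(apex_notin cK).
rewrite -(big_map (fun s => a |` s) predT g) -(big_map (fun s => b |` s) predT g).
rewrite -!big_cat /=; apply: perm_big; apply: uniq_perm; first exact: fset_uniq.
  rewrite !cat_uniq !map_inj_in_uniq ?fset_uniq /=; do ?exact: inj.
  rewrite !andbT; apply/andP; split.
    apply/hasPn => x; rewrite mem_cat => /orP[]/mapP[s sK ->]; apply/negP => h.
      by have := apex_notin aK h; rewrite fset1U1.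
    by have := apex_notin bK h; rewrite fset1U1.
  apply/hasPn => x /mapP[s sK ->]; apply/mapP => -[t tK /fsetP/(_ b)].
  by rewrite !inE eqxx eq_sym (negPf ab) (negPf (apex_notin bK tK)).
have mE c x : (x \in [fset c |` s | s in K]) = (x \in [seq c |` s | s <- K]).
  by apply/imfsetP/mapP => -[s sK ->]; exists s.
by move=> x; rewrite !mem_cat !in_fsetU !mE.
Qed.

(** A coface t of a face of K comes with two cones over t, of the opposite sign,
    so the alternating sum is negated; a face containing an apex only retains
    one of the cones, with the same effect. *)
Lemma eulerian_complex_suspension : eulerian_complex n.+1 suspension.
Proof.
case: eK => [[K0 dK] eu dimK [f fK fn]].
have apexE c s t : c \notin vertices K -> s \in K -> t \in K ->
    (s `<=` c |` t) = (s `<=` t).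
  move=> cK sK tK; rewrite -fsubDset.
  by congr (_ `<=` _); apply/fsetDidPl; rewrite fdisjointX1 (apex_notin cK sK).
have cardU c s : c \notin vertices K -> s \in K -> #|` c |` s| = #|` s|.+1.
  by move=> cK sK; rewrite cardfsU1 (apex_notin cK sK).
split.
- split; first by rewrite in_fsetU K0.
  move=> s t; rewrite !in_fsetU !mem_coneP // => /or3P[sK|/andP[xs sK]|/andP[xs sK]] ts.
  + by rewrite (dK _ _ sK ts).
  + have [at_|at_] := boolP (a \in t); first by rewrite (dK _ _ sK (fsetSD _ ts)) !orbT.
    by apply/orP; left; apply: (dK _ _ sK); apply/fsubsetD1P.
  + have [at_|at_] := boolP (b \in t); first by rewrite (dK _ _ sK (fsetSD _ ts)) !orbT.
    by apply/orP; left; apply: (dK _ _ sK); apply/fsubsetD1P.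
- have cone_case c d s : c \notin vertices K -> d \notin vertices K -> c != d ->
      s \in K -> \sum_(t <- K) ((if c |` s `<=` t then (-1) ^+ #|` t| else 0) +
        ((if c |` s `<=` c |` t then (-1) ^+ #|` c |` t| else 0) +
         (if c |` s `<=` d |` t then (-1) ^+ #|` d |` t| else 0)))
      = (-1) ^+ n.+1 :> int.
    move=> cK dK' cd sK; rewrite exprS -(eu s sK) mulr_sumr [RHS]big_mkcond.
    apply: (@eq_sum_seq int {fset V}) => // t tK _ /=.
    rewrite [c |` s `<=` t]fsubUset fsub1set (negPf (apex_notin cK tK)) /=.
    rewrite (_ : (c |` s `<=` d |` t) = false); last first.
      apply/negP => /fsubsetP/(_ c); rewrite !inE eqxx (negPf cd) /=.
      by rewrite (negPf (apex_notin cK tK)) => /(_ isT).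
    rewrite fsubUset fsub1set fset1U1 /= apexE // cardU // exprS add0r addr0.
    by case: ifP.
  move=> s; rewrite big_mkcond sum_suspension /=.
  rewrite !in_fsetU => /or3P[sK|/imfsetP[u /= uK ->]|/imfsetP[u /= uK ->]].
  + rewrite exprS -(eu s sK) mulr_sumr [RHS]big_mkcond.
    apply: (@eq_sum_seq int {fset V}) => // t tK _ /=.
    rewrite !apexE // !cardU // !exprS.
    by case: ifP => _; rewrite ?addr0 //; ring.
  + exact: cone_case.
  + rewrite -(cone_case b a u) // 1?eq_sym //.
    by apply: eq_bigr => t _; congr (_ + _); rewrite addrC.
- by move=> s; rewrite !in_fsetU => /or3P[/dimK/leqW //||]/imfsetP[u /= uK ->];
    rewrite cardU // ltnS dimK.
by exists (a |` f); rewrite ?cardU ?fn // !in_fsetU mem_coneP // fset1U1 fsetU1K ?fK ?orbT //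
  (apex_notin aK).
Qed.

(** The two apices and the empty face have F-polynomial x, and F-polynomials
    multiply under joins. *)
Lemma Fpoly_suspension (R : realType) :
  Fpoly R suspension = 'X * Fpoly R K.
Proof.
rewrite !Fpoly_sum_faces sum_suspension mulr_sumr; apply: eq_big_seq => s sK.
rewrite !cardfsU1 !(apex_notin _ sK) // !exprS.
have -> : ('X : {poly R}) = 1 + 2 * face_weight R.
  by rewrite /face_weight -polyC_natr mul_polyC scalerA mulfV ?pnatr_eq0 // scale1r; ring.
ring.
Qed.

End Suspension.

(** The boundary complex of the n-dimensional cross-polytope, with the pairs
    of antipodal vertices 2i and 2i + 1. *)
Fixpoint cross_polytope (n : nat) : {fset {fset nat}} :=
  if n is m.+1 then suspension (cross_polytope m) m.*2 m.*2.+1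
  else [fset fset0].

Lemma vertices_cross_polytope n x :
  x \in vertices (cross_polytope n) -> (x < n.*2)%N.
Proof.
case/verticesP=> s; elim: n s => [|n IH] s /=.
  by rewrite inE => /eqP ->.
rewrite !in_fsetU => /or3P[sK xs|/imfsetP[u /= uK ->]|/imfsetP[u /= uK ->]].
- by have := IH s sK xs; rewrite doubleS; lia.
- by rewrite !inE => /orP[/eqP ->|/(IH u uK)]; rewrite doubleS; lia.
- by rewrite !inE => /orP[/eqP ->|/(IH u uK)]; rewrite doubleS; lia.
Qed.

Lemma cross_polytope_apex n x : (n.*2 <= x)%N ->
  x \notin vertices (cross_polytope n).
Proof. by move=> nx; apply/negP => /vertices_cross_polytope; rewrite ltnNge nx. Qed.

Lemma eulerian_complex_cross_polytope n : eulerian_complex n (cross_polytope n).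
Proof.
elim: n => [|n IH] /=; last first.
  by apply: eulerian_complex_suspension; rewrite ?cross_polytope_apex // neq_ltn leqnn.
split.
- split; first by rewrite inE.
  by move=> s t; rewrite !inE => /eqP ->; rewrite fsubset0.
- move=> s; rewrite inE => /eqP ->.
  by rewrite big_mkcond big_seq_fset1 fsubset_refl cardfs0.
- by move=> s; rewrite inE => /eqP ->; rewrite cardfs0.
by exists fset0; rewrite ?inE ?cardfs0.
Qed.

Lemma Fpoly_cross_polytope (R : realType) n :
  Fpoly R (cross_polytope n) = 'X^n.
Proof.
elim: n => [|n IH] /=.
  by rewrite Fpoly_sum_faces big_seq_fset1 cardfs0 !expr0.
rewrite Fpoly_suspension ?IH ?exprS // ?neq_ltn ?leqnn //.
all: exact: cross_polytope_apex.
Qed.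

(** * The fan over a triangulated simplex *)

Lemma large_multiple_pos (R : realType) (I : eqType) (r : seq I) (x y : I -> R) :
  exists N : nat, forall m, (N <= m)%N ->
    forall i, i \in r -> 0 < x i -> 0 < m%:R * x i + y i.
Proof.
elim: r => [|i r [N IH]]; first by exists 0%N.
exists (maxn N (Num.bound (`|y i| / x i))) => m; rewrite geq_max => /andP[Nm bm] j.
rewrite inE => /orP[/eqP -> xi|jr]; last exact: IH.
have : `|y i| / x i < m%:R.
  apply: lt_le_trans (_ : (Num.bound (`|y i| / x i))%:R <= _); last by rewrite ler_nat.
  by apply: archi_boundP; rewrite divr_ge0 // ltW.
rewrite ltr_pdivrMr // => h.
have : - y i <= `|y i| by rewrite -normrN ler_norm.
lra.
Qed.

Lemma finite_pigeonhole (I : eqType) (r : seq I) (P : I -> nat -> Prop) N0 :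
  (forall m, (N0 <= m)%N -> exists2 i, i \in r & P i m) ->
  exists2 i, i \in r & forall N, exists2 m, (N <= m)%N & P i m.
Proof.
move=> h; apply: contrapT => nh.
have [N hN] : exists N, forall i, i \in r -> forall m, (N <= m)%N -> ~ P i m.
  have {h} : forall i, i \in r -> exists N, forall m, (N <= m)%N -> ~ P i m.
    move=> i ir; apply: contrapT => hi; apply: nh; exists i => // N.
    apply: contrapT => hN; apply: hi; exists N => m Nm Pm.
    by apply: hN; exists m.
  elim: r {nh} => [|i r IH] h; first by exists 0%N.
  have [|N1 h1] := IH; first by move=> j jr; apply: h; rewrite inE jr orbT.
  have [N2 h2] := h i (mem_head _ _).
  exists (maxn N1 N2) => j; rewrite inE => /orP[/eqP ->|jr] m; rewrite geq_max => /andP[? ?].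
    exact: h2.
  exact: h1.
have [i ir Pi] := h (maxn N N0) (leq_maxr _ _).
by apply: (hN i ir _ (leq_maxl _ _) Pi).
Qed.

(** The simplex spans the nonnegative orthant, and the cones over the faces of
    L form a simplicial fan in it.  Passing to cones makes the empty face
    behave as the others and removes all normalizations. *)
Section Fan.

Variables (R : realType) (k : nat) (W : choiceType).
Variables (L : {fset {fset W}}) (p : W -> 'rV[R]_k.+1).
Hypothesis tri : simplex_triangulation L p.

Definition comb (s : {fset W}) (a : W -> R) : 'rV[R]_k.+1 :=
  \sum_(w <- s) a w *: p w.

Lemma combE s a i : comb s a 0 i = \sum_(w <- s) a w * p w 0 i.
Proof. by rewrite summxE; apply: eq_bigr => w _; rewrite mxE. Qed.

Lemma combD s a b : comb s (fun w => a w + b w) = comb s a + comb s b.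
Proof. by rewrite -big_split; apply: eq_bigr => w _; rewrite scalerDl. Qed.

Lemma combZ s c a : comb s (fun w => c * a w) = c *: comb s a.
Proof. by rewrite scaler_sumr; apply: eq_bigr => w _; rewrite scalerA. Qed.

Lemma eq_comb s a b : {in s, a =1 b} -> comb s a = comb s b.
Proof. by move=> ab; apply: eq_big_seq => w ws; rewrite ab. Qed.

Lemma comb_sub s t a : t `<=` s ->
  (forall w, w \in s -> w \notin t -> a w = 0) -> comb t a = comb s a.
Proof.
by move=> ts h; apply: big_fset_incl => // w ws wt; rewrite h ?scale0r.
Qed.

Let cL : simplicial_complex L. Proof. by case: tri. Qed.

Lemma vertex_face w : w \in vertices L -> [fset w] \in L.
Proof. by case/verticesP=> s sL ws; apply: (proj2 cL) sL _; rewrite fsub1set. Qed.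

Lemma vertex_in_simplex w : w \in vertices L -> in_simplex (p w).
Proof.
move=> /vertex_face wL; case: tri => _ _ _ cov; apply/cov; exists [fset w] => //.
by exists (fun=> 1); split; rewrite ?big_seq_fset1 ?scale1r // => *; rewrite ler01.
Qed.

Lemma sum_comb s a : s \in L -> \sum_i comb s a 0 i = \sum_(w <- s) a w.
Proof.
move=> /sub_vertices/fsubsetP sL; under eq_bigr do rewrite combE.
rewrite exchange_big /=; apply: eq_big_seq => w /sL/vertex_in_simplex[_ pw].
by rewrite -mulr_sumr pw mulr1.
Qed.

Lemma comb_eq0 s a : s \in L -> comb s a = 0 -> forall w, w \in s -> a w = 0.
Proof.
move=> sL c0; case: tri => _ ind _ _; apply: (ind s sL) => //.
by rewrite -sum_comb // c0 big1 // => i _; rewrite mxE.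
Qed.

Lemma comb_inj s a b : s \in L -> comb s a = comb s b -> {in s, a =1 b}.
Proof.
move=> sL e w ws; apply/eqP; rewrite -subr_eq0; apply/eqP.
apply: (comb_eq0 (a := fun w => a w - b w) sL) => //.
rewrite (@eq_comb _ _ (fun w => a w + -1 * b w)); last by move=> x _; rewrite mulN1r.
by rewrite combD combZ e scaleN1r subrr.
Qed.

Lemma cone_cover (u : 'rV[R]_k.+1) : (forall i, 0 <= u 0 i) ->
  exists s (a : W -> R), [/\ s \in L, forall w, w \in s -> 0 <= a w & comb s a = u].
Proof.
move=> u0; have [S0|S0] := eqVneq (\sum_i u 0 i) 0.
  exists fset0, (fun=> 0); split; [by case: cL|by []|].
  rewrite /comb big_seq_fset0; apply/rowP => i; rewrite mxE.
  by move/eqP: S0; rewrite psumr_eq0 // => /allP/(_ i); rewrite mem_index_enum => /(_ isT)/eqP.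
have Sp : 0 < \sum_i u 0 i by rewrite lt_def S0 sumr_ge0.
case: tri => _ _ _ /(_ ((\sum_i u 0 i)^-1 *: u))[+ _].
case.
  split=> [i|]; first by rewrite mxE mulr_ge0 // invr_ge0 ltW.
  under eq_bigr do rewrite mxE.
  by rewrite -mulr_sumr mulVf.
move=> s sL [a [a0 _ e]]; exists s, (fun w => (\sum_i u 0 i) * a w); split=> // [w ws|].
  by rewrite mulr_ge0 ?a0 // ltW.
by rewrite combZ /comb e scalerA mulfV // scale1r.
Qed.

(** Two cones meet in the cone over the common face: a point of both cones,
    scaled into the simplex, lies in the hull of that face, and by independence
    its coordinates outside it vanish. *)
Lemma cone_meet s t a b : s \in L -> t \in L ->
  (forall w, w \in s -> 0 <= a w) -> (forall w, w \in t -> 0 <= b w) ->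
  comb s a = comb t b -> forall w, w \in s -> a w != 0 -> w \in t.
Proof.
move=> sL tL a0 b0 e w ws aw.
have eS : \sum_(w <- s) a w = \sum_(w <- t) b w by rewrite -!sum_comb // e.
set S := \sum_(w <- s) a w in eS.
have Sp : 0 < S.
  rewrite /S (big_rem w) //=; apply: ltr_pwDl; first by rewrite lt_def aw a0.
  by rewrite big_seq sumr_ge0 // => x /mem_rem/a0.
have hull r c : r \in L -> (forall w, w \in r -> 0 <= c w) ->
    \sum_(w <- r) c w = S -> in_hull p r (S^-1 *: comb r c).
  move=> rL c0 cS; exists (fun w => S^-1 * c w); split=> [x xr||].
  - by rewrite mulr_ge0 ?c0 // invr_ge0 ltW.
  - by rewrite -mulr_sumr cS mulVf // lt0r_neq0.
  - by rewrite -/(comb _ _) combZ.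
case: tri => _ _ /(_ s t sL tL (S^-1 *: comb s a)) h _.
have {h} [] := h (hull _ _ sL a0 erefl); first by rewrite e; apply: hull.
move=> c [c0 _ ec]; apply: contraNT aw => wt.
pose d x := if x \in t then c x else 0.
have dE : comb (s `&` t) c = comb s d.
  rewrite -(@comb_sub s (s `&` t)) ?fsubsetIl // => [|x xs]; last first.
    by rewrite inE xs /= /d => /negPf ->.
  by apply: eq_comb => x; rewrite inE /d => /andP[_ ->].
have : S^-1 * a w = d w.
  apply: (comb_inj (a := fun w => S^-1 * a w) sL) => //.
  by rewrite combZ -dE /comb ec.
rewrite /d (negPf wt) => /eqP; rewrite mulf_eq0 invr_eq0.
by rewrite (negPf (lt0r_neq0 Sp)).
Qed.

(** When u is generic, all cones whose span contains u are full-dimensional,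
    and u has no zero coordinate in them. *)
Definition generic (u : 'rV[R]_k.+1) : Prop :=
  forall s, s \in L -> (#|` s| <= k)%N -> forall a, comb s a <> u.

(** A point in the relative interior of the cone over t, pushed slightly in the
    direction u, arrives in the cone over M, in its relative interior.
    Expressed through the coordinates c of u in M: they must be positive where
    the coordinates of the point vanish.  For fixed M and generic u these t form
    the interval from the set of w with c w negative up to M, so the relation
    partitions the faces that flow somewhere into Boolean intervals. *)
Definition flows_into (u : 'rV[R]_k.+1) (t M : {fset W}) : Prop :=
  exists c : W -> R, [/\ M \in L, comb M c = u, t `<=` M
    & forall w, w \in M -> w \notin t -> 0 < c w].

(** The unnormalized barycentre, a convenient point of the relatively open
    cone over t. *)
Definition bary (t : {fset W}) := comb t (fun=> 1).

Lemma bary_ge0 t i : t \in L -> 0 <= bary t 0 i.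
Proof.
move=> /sub_vertices/fsubsetP tL; rewrite combE big_seq sumr_ge0 // => w /tL.
by case/vertex_in_simplex => h _; rewrite mul1r.
Qed.

Lemma comb_shift t M c m : t `<=` M ->
  comb M (fun w => m * (w \in t)%:R + c w) = m *: bary t + comb M c.
Proof.
move=> tM; rewrite combD combZ; congr (_ *: _ + _).
rewrite -(@comb_sub M t) // => [|w _ /negPf -> //].
by apply: eq_comb => w ->.
Qed.

(** Large multiples of the barycentre replace small multiples of u: the ray
    through bary t + u / m is that of m bary t + u. *)
Lemma flows_into_pos u t M : flows_into u t M ->
  exists (c : W -> R) (N : nat), [/\ M \in L, t `<=` M & forall m, (N <= m)%N ->
    (forall w, w \in M -> 0 < m%:R * (w \in t)%:R + c w) /\
    comb M (fun w => m%:R * (w \in t)%:R + c w) = m%:R *: bary t + u].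
Proof.
case=> c [ML <- tM cpos].
have [N hN] := large_multiple_pos M (fun w => (w \in t)%:R) c.
exists c, N; split=> // m Nm; split; last exact: comb_shift.
move=> w wM; have [wt|wt] := boolP (w \in t).
  by have := hN m Nm w wM; rewrite wt ltr01 => /(_ isT).
by rewrite mulr0 add0r cpos.
Qed.

Lemma flows_into_unique u t M M' :
  flows_into u t M -> flows_into u t M' -> M = M'.
Proof.
move=> /flows_into_pos[c [N [ML tM h]]] /flows_into_pos[c' [N' [M'L tM' h']]].
have [p1 e1] := h _ (leq_maxl N N'); have [p2 e2] := h' _ (leq_maxr N N').
apply/eqP; rewrite eqEfsubset; apply/andP; split; apply/fsubsetP => w wM.
  apply: (cone_meet ML M'L _ _ (etrans e1 (esym e2)) wM) => [x /p1/ltW //|x /p2/ltW //|].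
  by rewrite lt0r_neq0 // p1.
apply: (cone_meet M'L ML _ _ (etrans e2 (esym e1)) wM) => [x /p2/ltW //|x /p1/ltW //|].
by rewrite lt0r_neq0 // p2.
Qed.

Lemma flows_into_inward (u : 'rV[R]_k.+1) t M i :
  flows_into u t M -> bary t 0 i = 0 -> 0 <= u 0 i.
Proof.
move=> /flows_into_pos[c [N [ML tM h]]] ti; have [p1 e1] := h _ (leqnn N).
have := congr1 (fun x : 'rV_k.+1 => x 0 i) e1; rewrite /= !mxE ti mulr0 add0r => <-.
rewrite combE big_seq sumr_ge0 // => w wM; apply: mulr_ge0; first exact/ltW/p1.
by have [h0 _] := vertex_in_simplex (fsubsetP (sub_vertices ML) _ wM); apply: h0.
Qed.

Lemma generic_coord_neq0 u s c : s \in L -> #|` s| = k.+1 -> generic u ->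
  comb s c = u -> forall w, w \in s -> c w != 0.
Proof.
move=> sL cs gen e w ws; apply/eqP => cw.
have sub : s `\ w `<=` s := fsubD1set _ _.
have sL' := proj2 cL _ _ sL sub.
apply: (gen _ sL' _ c); first by have := cardfsD1 w s; rewrite ws cs; lia.
rewrite -e; apply: comb_sub => // x xs; rewrite !inE xs andbT negbK => /eqP ->.
exact: cw.
Qed.

End Fan.

(** * Generic directions and interior faces *)

Lemma exists_left_kernel (F : fieldType) m n (A : 'M[F]_(m, n)) :
  (\rank A < m)%N -> exists2 f : 'rV_m, f != 0 & f *m A = 0.
Proof.
move=> rA; have : kermx A != 0.
  by rewrite -mxrank_eq0 mxrank_ker subn_eq0 -ltnNge.
by case/rowV0Pn => f /sub_kermxP fA f0; exists f.
Qed.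

Section InteriorFaces.

Variables (R : realType) (k : nat) (W : choiceType).
Variables (L : {fset {fset W}}) (p : W -> 'rV[R]_k.+1).
Hypothesis tri : simplex_triangulation L p.

Let vmx (s : {fset W}) : 'M[R]_(#|` s|, k.+1) :=
  \matrix_i p (tnth (in_tuple (enum_fset s)) i).

Lemma face_card_le s : s \in L -> (#|` s| <= k.+1)%N.
Proof.
move=> sL; rewrite leqNgt; apply/negP => h.
have [|f f0 fA] := @exists_left_kernel _ _ _ (vmx s).
  exact: leq_ltn_trans (rank_leq_col _) h.
pose a w := oapp (fun i => f 0 i) 0 (insub (index w s) : option 'I_(#|` s|)).
have aE i : a (tnth (in_tuple (enum_fset s)) i) = f 0 i.
  by rewrite /a (tnth_nth (tnth (in_tuple (enum_fset s)) i)) /= index_uniq // valK.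
have c0 : comb p s a = 0.
  rewrite /comb big_tnth -[RHS]fA; apply/rowP => j; rewrite summxE mxE.
  by apply: eq_bigr => i _; rewrite !mxE aE.
case/negP: f0; apply/eqP/rowP => i; rewrite mxE -aE.
by apply: (comb_eq0 tri sL c0); apply: mem_tnth.
Qed.

(** A vector of the moment curve x |-> (1, x, ..., x^k) lies in a proper linear
    subspace only for the roots x of a nonzero polynomial, whose coefficients
    are those of a linear form vanishing on the subspace.  Finitely many
    polynomials leave some positive x. *)
Lemma exists_generic : exists2 v : 'rV[R]_k.+1,
  forall i, 0 < v 0 i & generic L p v.
Proof.
have [q qP] : exists q : {fset W} -> {poly R}, forall s, (#|` s| <= k)%N ->
    q s != 0 /\ forall a x, comb p s a = \row_i x ^+ i -> (q s).[x] = 0.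
  have : forall s : {fset W}, exists q : {poly R}, (#|` s| <= k)%N -> q != 0 /\
      forall a x, comb p s a = \row_i x ^+ i -> q.[x] = 0.
    move=> s.
    have [hs|hs] := leqP #|` s| k; last by exists 0.
    have [|f f0 fA] := @exists_left_kernel _ _ _ (vmx s)^T.
      by rewrite mxrank_tr ltnS; apply: leq_trans (rank_leq_row _) hs.
    exists (rVpoly f) => _; split.
      by apply: contraNneq f0 => e; rewrite -(rVpolyK f) e linear0.
    move=> a x e; rewrite horner_poly.
    transitivity (\sum_(i < k.+1) f 0 i * comb p s a 0 i).
      apply: eq_bigr => i _; rewrite e mxE; congr (_ * _).
      by rewrite (valK i).
    under eq_bigr do rewrite combE mulr_sumr.
    rewrite exchange_big /= big_tnth big1 // => j _.
    have := congr1 (fun y : 'rV_ #|` s| => y 0 j) fA; rewrite /= !mxE => fj.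
    transitivity (a (tnth (in_tuple (enum_fset s)) j) *
       \sum_i f 0 i * p (tnth (in_tuple (enum_fset s)) j) 0 i).
      by rewrite mulr_sumr; apply: eq_bigr => i _; ring.
    rewrite (_ : \sum_i _ = 0) ?mulr0 // -[RHS]fj.
    by apply: eq_bigr => i _; rewrite !mxE.
  by case/choice => q qP; exists q => s; apply: qP.
pose Q := \prod_(s <- L | (#|` s| <= k)%N) q s.
have Q0 : Q != 0.
  by rewrite /Q; elim/big_ind: _ => [|u v|s /qP[]//]; rewrite ?oner_neq0 //; apply: mulf_neq0.
have [x x0 Qx] : exists2 x : R, 0 < x & Q.[x] != 0.
  apply: contrapT => nx.
  have /(max_poly_roots Q0) : all (root Q) [seq i.+1%:R : R | i <- iota 0 (size Q)].
    apply/allP => _ /mapP[i _ ->]; apply/rootP/eqP/negPn/negP => h.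
    by apply: nx; exists i.+1%:R; rewrite ?ltr0Sn.
  rewrite map_inj_uniq ?iota_uniq => [/(_ isT)|i j /eqP].
    by rewrite size_map size_iota ltnn.
  by rewrite eqr_nat => /eqP[].
exists (\row_i x ^+ i) => [i|s sL hs a e]; first by rewrite mxE exprn_gt0.
case/negP: Qx; rewrite /Q horner_prod (big_rem s) //= hs.
by rewrite (proj2 (qP s hs) a x e) mul0r.
Qed.

(** The points m bary t + u stay in the orthant for large m, so one cone s
    contains infinitely many of them.  Hence bary t and u are in its span, with
    coordinates b and c such that m b + c is nonnegative for arbitrarily large
    m; this forces b to be nonnegative, so t is a face of s, and c to be
    nonnegative, and positive by genericity, where b vanishes. *)
Lemma flows_into_exists (u : 'rV[R]_k.+1) t : t \in L -> generic L p u ->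
  (forall i, bary p t 0 i = 0 -> 0 < u 0 i) -> exists M, flows_into L p u t M.
Proof.
move=> tL gen hu.
have [N0 hN0] := large_multiple_pos (index_enum 'I_k.+1) (fun i => bary p t 0 i)
  (fun i => u 0 i).
have [s sL hs] : exists2 s, s \in L & forall N, exists2 m, (N <= m)%N &
    exists2 a : W -> R, forall w, w \in s -> 0 <= a w &
      comb p s a = m%:R *: bary p t + u.
  apply: (@finite_pigeonhole _ L (fun s m => exists2 a : W -> R,
    forall w, w \in s -> 0 <= a w & comb p s a = m%:R *: bary p t + u) N0) => m hm.
  have [|s [a [sL a0 e]]] := @cone_cover _ _ _ _ _ tri (m%:R *: bary p t + u).
    move=> i; rewrite !mxE; have [z|nz] := eqVneq (bary p t 0 i) 0.
      by rewrite z mulr0 add0r ltW // hu.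
    by apply/ltW/hN0; rewrite ?mem_index_enum // lt_def nz (bary_ge0 tri).
  by exists s => //; exists a.
(* Two of the points span the same subspace as bary t and u. *)
have [m1 _ [a1 a10 e1]] := hs 0%N; have [m2 m12 [a2 a20 e2]] := hs m1.+1.
have m12R : m2%:R - m1%:R != 0 :> R by rewrite subr_eq0 eqr_nat; lia.
pose b w := (m2%:R - m1%:R)^-1 * (a2 w + -1 * a1 w).
have bE : comb p s b = bary p t.
  rewrite combZ combD combZ e1 e2 scaleN1r opprD addrACA subrr addr0 -scalerBl.
  by rewrite scalerA mulVf // scale1r.
pose c w := a1 w + - m1%:R * b w.
have cE : comb p s c = u by rewrite combD combZ bE e1 scaleNr addrAC subrr add0r.
have hs' N : exists2 m, (N <= m)%N & forall w, w \in s -> 0 <= m%:R * b w + c w.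
  have [m Nm [a a0 e]] := hs N; exists m => // w ws.
  rewrite (_ : m%:R * b w + c w = a w) ?a0 //.
  apply: (comb_inj (a := fun w => m%:R * b w + c w) tri sL) => //.
  by rewrite combD combZ bE cE e.
have b0 w : w \in s -> 0 <= b w.
  move=> ws; rewrite leNgt; apply/negP => bw.
  have [N hN] := large_multiple_pos s (fun w => - b w) (fun w => - c w).
  have [m Nm /(_ w ws)] := hs' N; have := hN m Nm w ws; rewrite oppr_gt0 => /(_ bw).
  lra.
have ts : t `<=` s.
  apply/fsubsetP => w wt.
  apply: (cone_meet tri tL sL (a := fun=> 1) (b := b)) => //; last exact: oner_neq0.
exists s, c; split=> // w ws wt.
have bw : b w = 0.
  apply/eqP; apply: contraNT wt.
  by apply: (cone_meet tri sL tL (a := b) (b := fun=> 1)) => // *; apply: ler01.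
have cs : #|` s| = k.+1.
  apply/eqP; rewrite eqn_leq face_card_le // ltnNge; apply/negP => h.
  exact: gen sL h _ cE.
have [m _ /(_ w ws)] := hs' 0%N; rewrite bw mulr0 add0r lt_def => ->.
by rewrite (generic_coord_neq0 tri sL cs gen cE).
Qed.

Lemma boundary_bary a : a \in L ->
  reflect (exists i, bary p a 0 i = 0) (a \in boundary L p).
Proof.
move=> aL; have aLv := fsubsetP (sub_vertices aL).
apply: (iffP idP) => [|[i ai]].
  rewrite !inE => /andP[_ /asboolP h].
  have [a0|a0] := eqVneq a fset0.
    by exists ord0; rewrite a0 combE big_seq_fset0.
  have ca : (#|` a|%:R : R) != 0 by rewrite pnatr_eq0 cardfs_eq0.
  have [|_ [i hi]] := h (#|` a|%:R^-1 *: bary p a).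
    exists (fun=> #|` a|%:R^-1); split=> [w _||]; first by rewrite invr_ge0.
    - by rewrite big_const_seq count_predT iter_addr_0 -(mulr_natr (_^-1)) mulVf.
    - by rewrite scaler_sumr; apply: eq_bigr => w _; rewrite scale1r.
  exists i; move: hi; rewrite mxE => /eqP; rewrite mulf_eq0 invr_eq0 (negPf ca).
  by move/eqP.
rewrite !inE aL /=; apply/asboolP => x hx; split.
  by case: tri => _ _ _ cov; apply/cov; exists a.
exists i; case: hx => c [_ _ <-]; rewrite -/(comb p a c) combE big_seq big1 // => w wa.
suff -> : p w 0 i = 0 by rewrite mulr0.
move/eqP: ai; rewrite combE big_seq psumr_eq0 => [/allP/(_ w wa)|].
  by rewrite wa mul1r => /eqP.
by move=> y /aLv/(vertex_in_simplex tri)[h _]; rewrite mul1r.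
Qed.

(** Let v be generic and positive.  Pushed along - v, a face flows into a unique
    M if it is interior, and leaves the orthant otherwise; so the sum runs over
    pairs (t, M).  For fixed M, with coordinates c of v, the t form the interval
    from a together with N, the set of w in M with 0 < c w, up to M, which
    contributes only if it is reduced to M.  That happens exactly when a flows into M along
    v, and v points into the orthant everywhere, so there is one such M. *)
Lemma euler_interior_faces a : a \in L ->
  \sum_(t <- L | (t \notin boundary L p) && (a `<=` t)) (-1) ^+ #|` t| =
    (-1) ^+ k.+1 :> int.
Proof.
move=> aL; have [v v0 gv] := exists_generic.
have gNv : generic L p (- v).
  move=> s sL cs c e; apply: (gv s sL cs (fun w => -1 * c w)).
  by rewrite combZ e scaleN1r opprK.
pose MM := [fset M in L | `[< exists c, comb p M c = v >]].
have MMP M : reflect (M \in L /\ exists c, comb p M c = v) (M \in MM).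
  by rewrite !inE; apply: (iffP andP) => -[ML /asboolP].
have cardM M : M \in MM -> #|` M| = k.+1.
  case/MMP=> ML [c e]; apply/eqP; rewrite eqn_leq face_card_le // ltnNge.
  by apply/negP => h; apply: gv ML h c e.
have flowMM u t M : u = v \/ u = - v -> flows_into L p u t M -> M \in MM.
  move=> uv [c [ML e _ _]]; apply/MMP; split=> //; case: uv => uE.
    by exists c; rewrite e.
  by exists (fun w => -1 * c w); rewrite combZ e uE scaleN1r opprK.
have count (u : 'rV_k.+1) t : u = v \/ u = - v -> (exists M, flows_into L p u t M) ->
    \sum_(M <- MM) (`[< flows_into L p u t M >] : nat)%:R = 1 :> int.
  move=> uv [M fM]; rewrite (big_rem M) ?(flowMM u t) //= asboolT // big_seq big1 ?addr0 //.
  move=> M'; rewrite mem_rem_uniq ?fset_uniq // !inE => /andP[M'M _].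
  rewrite asboolF // => fM'; case/eqP: M'M.
  exact: flows_into_unique fM' fM.
transitivity (\sum_(t <- L | a `<=` t) \sum_(M <- MM)
   (`[< flows_into L p (- v) t M >] : nat)%:R * (-1) ^+ #|` t| : int).
  rewrite big_mkcond [RHS]big_mkcond; apply: (@eq_sum_seq int {fset W}) => // t tL _.
  rewrite -mulr_suml; case: (boundary_bary tL) => [[i ti]|nt] /=.
    rewrite big1 ?mul0r ?if_same // => M _; rewrite asboolF // => fM.
    by have := flows_into_inward tri fM ti; rewrite mxE oppr_ge0 leNgt v0.
  rewrite count ?mul1r //; first by right.
  by apply: flows_into_exists => // i ti; case: nt; exists i.
rewrite exchange_big /=.
transitivity (\sum_(M <- MM) (`[< flows_into L p v a M >] : nat)%:R * (-1) ^+ k.+1 : int).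
  apply: eq_big_seq => M /[dup] MMM /MMP[ML [c cE]].
  have cn0 := generic_coord_neq0 tri ML (cardM _ MMM) gv cE.
  pose N := [fset w in M | 0 < c w].
  have flowE t : `[< flows_into L p (- v) t M >] = (t `<=` M) && (N `<=` t).
    apply/asboolP/andP => [[d [_ e tM dP]]|[tM Nt]].
      split=> //; apply/fsubsetP => w; rewrite !inE /= => /andP[wM cw].
      apply: contraTT cw => wt; rewrite -leNgt.
      have := comb_inj (a := d) (b := fun w => -1 * c w) tri ML.
      rewrite combZ cE scaleN1r => /(_ e w wM) dw.
      by have := dP w wM wt; rewrite dw mulN1r oppr_gt0 => /ltW.
    exists (fun w => -1 * c w); split=> //; first by rewrite combZ cE scaleN1r.
    move=> w wM wt; rewrite mulN1r oppr_gt0 lt_neqAle cn0 //= leNgt.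
    by apply: contra wt => cw; apply: (fsubsetP Nt); rewrite !inE wM.
  have flowE' : `[< flows_into L p v a M >] = (a `<=` M) && (a `|` N == M).
    apply/asboolP/andP => [[d [_ e aM dP]]|[aM /eqP aN]].
      split=> //; rewrite eqEfsubset fsubUset aM /=; apply/andP; split.
        by apply/fsubsetP => w; rewrite !inE => /andP[].
      apply/fsubsetP => w wM; rewrite inE; case: (boolP (w \in a)) => //= wa.
      rewrite !inE wM /= -(comb_inj (a := d) (b := c) tri ML) ?dP //.
      by rewrite e cE.
    exists c; split=> // w; rewrite -{1}aN inE => /orP[->//|].
    by rewrite !inE => /andP[].
  rewrite flowE'; under eq_bigr do rewrite flowE.
  have [aM|aM] := boolP (a `<=` M); last first.
    rewrite mul0r big1 // => t at_; rewrite (_ : t `<=` M = false) ?mul0r //.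
    by apply: contraNF aM => tM; exact: fsubset_trans at_ tM.
  have aNM : a `|` N `<=` M.
    by rewrite fsubUset aM; apply/fsubsetP => w; rewrite !inE => /andP[].
  transitivity (\sum_(t <- fpowerset M | a `|` N `<=` t) (-1) ^+ #|` t| : int).
    transitivity (\sum_(t <- L | (a `<=` t) && ((t `<=` M) && (N `<=` t)))
       (-1) ^+ #|` t| : int).
      rewrite [RHS]big_mkcondr; apply: eq_bigr => t _.
      by case: ifP => _; rewrite ?mul1r ?mul0r.
    rewrite -big_filter -[RHS]big_filter; apply: perm_big; apply: uniq_perm.
    - by rewrite filter_uniq ?fset_uniq.
    - by rewrite filter_uniq ?fset_uniq.
    move=> t; rewrite !mem_filter fpowersetE fsubUset.
    have [tM|] := boolP (t `<=` M); rewrite ?andbF //=.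
    by rewrite (proj2 (let: And4 cL _ _ _ := tri in cL) _ _ ML tM).
  rewrite alternating_sum_interval //; case: eqP => _; last by rewrite mul0r.
  by rewrite mul1r cardM.
rewrite -mulr_suml count ?mul1r //; first by left.
by apply: flows_into_exists.
Qed.

End InteriorFaces.

(** * The boundary of the triangulation *)

Section SimplexBoundary.

Variables (R : realType) (k : nat) (W : choiceType).
Variables (L : {fset {fset W}}) (p : W -> 'rV[R]_k.+1).
Hypothesis tri : simplex_triangulation L p.

Lemma placement_inj : {in vertices L &, injective p}.
Proof.
move=> x y xL yL e; apply/eqP; rewrite -in_fset1.
apply: (cone_meet tri (vertex_face tri xL) (vertex_face tri yL)
  (a := fun=> 1) (b := fun=> 1)) => [? _|? _|||].
- exact: ler01.
- exact: ler01.
- by rewrite /comb !big_seq_fset1 e.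
- by rewrite in_fset1.
- exact: oner_neq0.
Qed.

Lemma comb_coord_eq0 s a i w : s \in L -> (forall w, w \in s -> 0 <= a w) ->
  comb p s a 0 i = 0 -> w \in s -> a w != 0 -> p w 0 i = 0.
Proof.
move=> sL a0 e ws aw; move/eqP: e; rewrite combE big_seq psumr_eq0.
  by move/allP/(_ w ws); rewrite ws /= mulf_eq0 (negPf aw) => /eqP.
move=> y ys; rewrite mulr_ge0 ?a0 //.
by have [h _] := vertex_in_simplex tri (fsubsetP (sub_vertices sL) _ ys); apply: h.
Qed.

(** The corners of the simplex are extreme points, hence vertices of L. *)
Lemma corner_vertex i : exists2 w, w \in vertices L & p w = delta_mx 0 i.
Proof.
have [|s [a [sL a0 e]]] := @cone_cover _ _ _ _ _ tri (delta_mx 0 i).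
  by move=> j; rewrite mxE eqxx ler0n.
have [w ws aw] : exists2 w, w \in s & a w != 0.
  apply: contrapT => h; have := congr1 (fun x : 'rV_k.+1 => x 0 i) e.
  rewrite /= combE mxE !eqxx big_seq big1 => [/esym/eqP|w ws]; first by rewrite oner_eq0.
  apply/eqP; rewrite mulf_eq0; apply/orP; left; apply/negPn/negP => aw.
  by apply: h; exists w.
have wL := fsubsetP (sub_vertices sL) _ ws; exists w => //.
have pw j : j != i -> p w 0 j = 0.
  move=> ji; apply: (comb_coord_eq0 sL a0 _ ws aw).
  by rewrite e mxE eqxx (negPf ji).
apply/rowP => j; rewrite mxE eqxx /=; have [->|ji] := eqVneq j i; last exact: pw.
case: (vertex_in_simplex tri wL) => _; rewrite (bigD1 i) //= big1 ?addr0 //.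
Qed.

Lemma boundary_sub : boundary L p `<=` L.
Proof. by apply/fsubsetP => s; rewrite !inE => /andP[]. Qed.

Hypotheses (k1 : (1 <= k)%N) (nb : no_new_boundary_vertex L p).

Lemma boundary_vertexP w : w \in vertices L ->
  reflect (exists i, p w = delta_mx 0 i) (w \in vertices (boundary L p)).
Proof.
move=> wL; apply: (iffP idP) => [/verticesP[s sB ws]|[i pw]].
  apply: nb => //; move: sB; rewrite !inE => /andP[sL /asboolP]; apply.
  exists (fun x => (x == w)%:R); split=> [x _||]; first exact: ler0n.
    rewrite (big_rem w) //= eqxx big_seq big1 ?addr0 // => x.
    by rewrite mem_rem_uniq ?fset_uniq // inE => /andP[/negPf ->].
  rewrite (big_rem w) //= eqxx scale1r big_seq big1 ?addr0 // => x.
  by rewrite mem_rem_uniq ?fset_uniq // inE => /andP[/negPf ->]; rewrite scale0r.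
apply/verticesP; exists [fset w]; last by rewrite in_fset1.
apply/(boundary_bary tri (vertex_face tri wL)).
have [j ji] : exists j : 'I_k.+1, j != i.
  have [->|i0] := eqVneq i ord0; last by exists ord0; rewrite eq_sym.
  by exists ord_max; rewrite -val_eqE /= -lt0n.
by exists j; rewrite /bary /comb big_seq_fset1 scale1r pw mxE eqxx (negPf ji).
Qed.

Lemma card_boundary_vertices : #|` vertices (boundary L p)| = k.+1.
Proof.
have [c cP] : exists c : 'I_k.+1 -> W, forall i, c i \in vertices L /\ p (c i) = delta_mx 0 i.
  have : forall i, exists w, w \in vertices L /\ p w = delta_mx 0 i.
    by move=> i; have [w ? ?] := corner_vertex i; exists w.
  by case/choice => c cP; exists c.
have -> : vertices (boundary L p) = [fset c i | i in 'I_k.+1].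
  apply/fsetP => w; apply/idP/imfsetP => [wB|[i _ ->]]; last first.
    by case: (cP i) => cL pc; apply/boundary_vertexP => //; exists i.
  have wL : w \in vertices L.
    case/verticesP: wB => s /(fsubsetP boundary_sub) sL ws.
    by apply/verticesP; exists s.
  have [i pw] := elimT (boundary_vertexP wL) wB.
  by exists i => //; apply: placement_inj => //; rewrite ?pw; case: (cP i).
rewrite card_imfset /=; first by rewrite size_enum_ord.
move=> i j e; have := congr1 p e; rewrite (proj2 (cP i)) (proj2 (cP j)).
move/rowP/(_ i); rewrite !mxE !eqxx /= => /eqP.
by have [//|_] := eqVneq i j; rewrite oner_eq0.
Qed.

(** Since all boundary vertices are corners, the face of the simplex spanned by
    a proper set of corners cannot be subdivided: a cone of L containing its
    barycentre involves corners only, among them all those of the face. *)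
Lemma boundary_face_proper a :
  (a \in boundary L p) = (a `<` vertices (boundary L p)).
Proof.
have vL w : w \in vertices (boundary L p) -> w \in vertices L.
  case/verticesP=> s /(fsubsetP boundary_sub) sL ws.
  by apply/verticesP; exists s.
apply/idP/idP => [aB|].
  have aL := fsubsetP boundary_sub _ aB.
  rewrite fproperEneq sub_vertices // andbT.
  have [i ai] := elimT (boundary_bary tri aL) aB.
  have [w wL pw] := corner_vertex i.
  apply/eqP => e; have wa : w \in a by rewrite e; apply/boundary_vertexP => //; exists i.
  have := comb_coord_eq0 aL (fun _ _ => ler01) ai wa (oner_neq0 _).
  by rewrite pw mxE !eqxx => /eqP; rewrite oner_eq0.
rewrite fproperE => /andP[/fsubsetP aB /fsubsetPn[w0 w0B w0a]].
have [i0 pw0] := elimT (boundary_vertexP (vL _ w0B)) w0B.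
have ai0 : bary p a 0 i0 = 0.
  rewrite combE big_seq big1 // => w wa; rewrite mul1r.
  have wB := aB _ wa; have [i pw] := elimT (boundary_vertexP (vL _ wB)) wB.
  rewrite pw mxE eqxx /=; case: eqP => // ii0; case/negP: w0a.
  by rewrite -(placement_inj (vL _ wB) (vL _ w0B)) // pw pw0 ii0.
have pge0 w i : w \in vertices L -> 0 <= p w 0 i.
  by move=> wL; have [h _] := vertex_in_simplex tri wL; apply: h.
have aL : a \in L.
  have [|s [b [sL b0 e]]] := @cone_cover _ _ _ _ _ tri (bary p a).
    move=> i; rewrite combE big_seq sumr_ge0 // => w /aB/vL wL.
    by rewrite mul1r pge0.
  have svL := fsubsetP (sub_vertices sL).
  have [[_ dL] _ _ _] := tri; apply: (dL s a sL).
  apply/fsubsetP => w wa; have wB := aB _ wa.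
  have [j pw] := elimT (boundary_vertexP (vL _ wB)) wB.
  have [w' w's h] : exists2 w', w' \in s & b w' * p w' 0 j != 0.
    apply: contrapT => h; have : comb p s b 0 j = 0.
      rewrite combE big_seq big1 // => w' w's; apply/eqP/negPn/negP => bw'.
      by apply: h; exists w'.
    rewrite e combE => /eqP; rewrite big_seq psumr_eq0.
      by move/allP/(_ w wa); rewrite wa mul1r pw mxE !eqxx oner_eq0.
    by move=> x /aB/vL xL; rewrite mul1r pge0.
  move: h; rewrite mulf_eq0 negb_or => /andP[bw' pw'].
  have : w' \in vertices (boundary L p).
    apply/boundary_vertexP; first exact: svL.
    apply: nb; first exact: svL.
    split; first by apply: (vertex_in_simplex tri); exact: svL.
    by exists i0; apply: (comb_coord_eq0 sL b0 _ w's bw'); rewrite e.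
  move=> w'B; have [j' pwj'] := elimT (boundary_vertexP (vL _ w'B)) w'B.
  move: pw'; rewrite pwj' mxE eqxx /=; case: (eqVneq j j') => [jj' _|]; last by rewrite eqxx.
  by rewrite (placement_inj (vL _ wB) (vL _ w'B)) // pw pwj' jj'.
by apply/(boundary_bary tri aL); exists i0.
Qed.

Lemma eulerian_ball_triangulation : eulerian_ball k L (boundary L p).
Proof.
split.
- by case: tri.
- exact: boundary_face_proper.
- exact: boundary_sub.
- exact: card_boundary_vertices.
- exact: (face_card_le tri).
- have [v v0 gv] := exists_generic L p.
  have L0 : fset0 \in L by case: tri => -[].
  have [M [c [ML e _ _]]] := flows_into_exists tri L0 gv (fun i _ => v0 i).
  exists M => //; apply/eqP; rewrite eqn_leq (face_card_le tri) // ltnNge.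
  by apply/negP => h; apply: gv ML h c e.
- exact: (euler_interior_faces tri).
Qed.

End SimplexBoundary.

(** * Generalized Tchebyshev polynomials *)

(** Positivity beyond 1 transfers to the left of -1 by parity. *)
Lemma roots_in_unit_interval (R : realType) (p : {poly R}) n :
  p \Po (- 'X) = (-1) ^+ n *: p -> (forall x, 1 <= x -> 1 <= p.[x]) ->
  forall x, root p x -> -1 < x < 1.
Proof.
move=> pN p1 x /rootP px.
have le1 y : p.[y] = 0 -> y < 1.
  by move=> py; rewrite ltNge; apply/negP => /p1; rewrite py ler10.
rewrite le1 // andbT ltrNl le1 //.
have := congr1 (fun q => q.[x]) pN.
by rewrite horner_comp hornerN hornerX hornerZ px mulr0.
Qed.

(** The map T is only known on F-polynomials; the cross-polytope makes the
    monomials accessible. *)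
Lemma tchebyshev_map_monomial (R : realType) k (W : choiceType)
    (L : {fset {fset W}}) (p : W -> 'rV[R]_k.+1)
    (T : {linear {poly R} -> {poly R}}) n :
  eulerian_ball k L (boundary L p) -> tchebyshev_map L p T ->
  exists2 K : {fset {fset nat}}, eulerian_complex n K & T 'X^n = Fpoly R K.
Proof.
move=> LB TP; have eK := eulerian_complex_cross_polytope n.
have sgP s : s \in faces_card (cross_polytope n) k.+1 -> #|` s| = k.+1.
  by rewrite !inE => /andP[_ /eqP].
have [Ks [Ks0 eKs rKs]] := exists_replacement_sequence LB eK sgP.
exists (Ks (size (faces_card (cross_polytope n) k.+1))); first exact: eKs.
rewrite -(Fpoly_cross_polytope R n); apply: TP; first by case: eK.
exists (faces_card (cross_polytope n) k.+1), Ks; split=> //.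
  by split; first exact: fset_uniq.
by move=> i /eKs[].
Qed.

Theorem theorem5p4 (R : realType) (k : nat) (W : choiceType)
    (L : {fset {fset W}}) (p : W -> 'rV[R]_k.+1)
    (T : {linear {poly R} -> {poly R}}) :
  (1 <= k)%N ->
  simplex_triangulation L p ->
  no_new_boundary_vertex L p ->
  tchebyshev_map L p T ->
  forall n : nat,
    [/\ size (T 'X^n) = n.+1,
        (T 'X^n).[1] = 1,
        (-1) ^+ n *: (T 'X^n \Po (- 'X)) = T 'X^n
      & forall x : R, root (T 'X^n) x -> -1 < x < 1].
Proof.
move=> k1 tri nb TP n.
have LB := eulerian_ball_triangulation tri k1 nb.
have [K eK ->] := tchebyshev_map_monomial n LB TP.
have K0 : fset0 \in K by case: eK => -[].
split.
- exact: size_Fpoly eK.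
- exact: Fpoly_at1.
- by rewrite (Fpoly_reciprocity R eK) scalerA -exprMn mulrNN mulr1 expr1n scale1r.
- by apply: (roots_in_unit_interval (Fpoly_reciprocity R eK)) => x; apply: Fpoly_ge1.
Qed.
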